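(* Let $P$ be a point set as in the context, let $\mathcal{T}^*$ be a minimum weight triangulation of $P$, and for each $\gamma\in(\frac13,1)$ run the level-by-level algorithm described in the context. Suppose that, for every $\gamma$ and every level $i\in\{0,\ldots,L\}$ with $L=\log_3(9\Delta)+1$, the following two invariants hold: (Invariant 1) $\hat{\mathcal{A}}_i$ is a PSLG and every edge $uv\in\hat{\mathcal{A}}_i\setminus\mathcal{A}_i$ has length $\|uv\|\le 4\sqrt2\cdot\gamma 3^{i-1}$; (Invariant 2) $|\hat{\mathcal{A}}_i|\ge|\mathcal{T}^*_i|$, where $\mathcal{T}^*_i$ is the set of edges of $\mathcal{T}^*$ of length at most $\gamma 3^{i-1}/\sqrt2$. Then the output $\mathcal{A}_L$ of the algorithm is an $\alpha$-approximate minimum weight triangulation of $P$, i.e. $w(\mathcal{A}_L)\le\alpha\, w(\mathcal{T}^* )$, with $\alpha=w(\mathcal{A}_L)/w(\mathcal{T}^* )\le 24$. Furthermore, when $\gamma$ is chosen uniformly at random from $(\frac13,1)$, the expected value of $\alpha$ is at most $16$.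
   Context: **Point set and grids.** $P\subset\mathbb{R}^2$ is a set of $n$ points, no three collinear, with closest pair at distance $1$ and diameter at most $\Delta$, where $\Delta$ is a power of $3$; $P$ lies in an axis-parallel $3\Delta\times3\Delta$ square with opposite corners $(0,0)$ and $(3\Delta,3\Delta)$. For $\gamma\in(\frac13,1)$ and $L=\log_3(9\Delta)+1$, the grid $G_L$ consists of the single square with opposite corners $(0,0)$ and $(9\gamma\Delta,9\gamma\Delta)$, and $G_i$ is obtained from $G_{i+1}$ by splitting each cell into $3\times3$ equal cells, for $i=L-1,\ldots,0$. Cells of $G_i$ have side $\gamma3^{i-1}$. No point of $P$ lies on a grid line. For a cell $C$ of $G_i$, $N(C)$ is the set of cells of $G_i$ whose boundary meets that of $C$ (including $C$ itself, at most nine cells), $\mathcal{N}(C)$ is their union, and $\mathcal{N}(p)=\mathcal{N}(C)$ for $p\in P\cap C$. The adjacency graph $\mathcal{G}_i$ has vertex set $P$ and an edge $uv$ ($u\ne v$) iff $u\in\mathcal{N}(v)$ in $G_i$. So $\mathcal{G}_0=\emptyset$, $\mathcal{G}_i\subseteq\mathcal{G}_{i+1}$, $\mathcal{G}_L$ is complete. Level $i$ edges: $\mathcal{S}_i=\mathcal{G}_i\setminus\mathcal{G}_{i-1}$. Graphs are identified with their edge sets. **PSLGs and faces.** A PSLG on $P$ is a straight-line graph on $P$ no two of whose edges have intersecting open segments; a PSLG contained in a graph $\mathcal{G}$ is maximal in $\mathcal{G}$ if no other edge of $\mathcal{G}$ can be added without crossing. A triangulation is a maximal PSLG of the complete graph.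 The weight $w$ of a triangulation is the sum of its Euclidean edge lengths; a minimum weight triangulation minimizes $w$. Faces of a PSLG are the connected components of the plane minus points and edges. A bounded face is triangulated if its boundary is a single connected component with exactly three edges and three vertices; all other faces are non-triangulated. For each connected component of the boundary of a non-triangulated face $f$, the vertex sequence $\sigma(f)=\langle v_0,\ldots,v_{m-1}\rangle$ is the cyclic sequence of vertices met when walking along that component with $f$ on the right (an edge with $f$ on both sides is traversed twice, so vertices may repeat as distinct elements); indices are mod $m$. An element $v_i$ is convex if one turns right at $v_i$ going $v_{i-1},v_i,v_{i+1}$, and reflex otherwise (including $v_{i-1}=v_{i+1}$). The chain $\mathbb{C}(v_i,v_j)$ is $\langle v_i,v_{i+1},\ldots,v_j\rangle$; its interior is all its elements except the first and the last; $|\mathbb{C}(v_i,v_j)|$ is its number of elements; a reflex chain has only reflex elements, and is maximal if it cannot be extended on either side. $v_i$ and $v_j$ are visible to each other with respect to $f$ if $\overline{v_iv_j}\subset f$ (open segment) and adding $v_iv_j$ splits $f$ into faces with sequences $\langle v_i,\ldots,v_j\rangle$ and $\langle v_i,v_j,v_{j+1},\ldots,v_{i-1}\rangle$. The forward convex vertex of $v_j$ is $v_k$ with $k>j$ least such that $v_{k \bmod m}$ is convex, and its forward support vertex is $v_{k+1}$. For reflex $v_j$, its backward convex vertex is $v_k$ with $k<j$ largest such that $v_{k\bmod m}$ is convex, and its backward support vertex is $v_{k-1}$. **Algorithm.** $\mathcal{A}_0=\emptyset$. For $i=0,\ldots,L-1$, $\mathcal{A}_{i+1}$ is built from $\mathcal{A}_i$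 as follows; the output is $\mathcal{A}_L$ (with $\hat{\mathcal{A}}_L=\mathcal{A}_L$). *Phase 1.* Set $\hat{\mathcal{A}}_i=\mathcal{A}_i$. For every non-triangulated face $f$ of $\mathcal{A}_i$ and every vertex sequence $\sigma(f)=\langle v_0,\ldots,v_{m-1}\rangle$ of $f$: let the start vertex $v_j$ be any element that is the backward support vertex of some element of $\sigma(f)$, or $v_0$ if there is none. Set $k=0$ and $f'=f$ (with sequence $\sigma(f')$ maintained). Repeat until $k>m-1$: (1) Let $v_{l-1},v_l$ be the forward convex and forward support vertices of $v_{j+k}$ in $\sigma(f)$ (if there is no convex element, no edges are added). Mark $v_{j+k}$ visited. If $v_l$ is visible to $v_{j+k}$ with respect to $f$ and $v_{l-1}\in\mathcal{N}(v_{j+k})$ (in $G_i$), set $\mathbb{C}(v_{j+k})=\mathbb{C}(v_{j+k},v_l)$; otherwise set $\mathbb{C}(v_{j+k})=\mathbb{C}(v_{j+k},v_{j+k+1})$. If $v_{l-1}$ is not visited and $|\mathbb{C}(v_{j+k})|>2$: (a) if $v_{l+1}$ is reflex, with backward convex vertex $v_{q+1}$ and backward support vertex $v_q$, and if $v_{q+1}\in\mathcal{N}(v_{l+1})$ and $v_q$ is visible to $v_{l+1}$ with respect to $f$, let $\mathbb{C}(v_{l+1},v_r)$ be the maximal reflex chain starting at $v_{l+1}$, let $v_s$ be its last element with $v_{q+1}\in\mathcal{N}(v_s)$ and $v_q$ visible to $v_s$ in $f$, and set $\mathbb{C}(v_{j+k})=\mathbb{C}(v_{j+k},v_s)$; (b)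 add to $\hat{\mathcal{A}}_i$ an edge from $v_l$ to every element of $\mathbb{C}(v_{j+k},v_{l-2})$ and, if $\mathbb{C}(v_{j+k})=\mathbb{C}(v_{j+k},v_s)$, also an edge from $v_{j+k}$ to every element of $\mathbb{C}(v_{l+1},v_s)$; mark all elements of $\mathbb{C}(v_{j+k})$ visited, remove the interior of $\mathbb{C}(v_{j+k})$ from $\sigma(f')$, and increase $k$ by the number of edges just added plus $1$. If instead $v_{l-1}$ is already visited and $|\mathbb{C}(v_{j+k})|>2$: (c) let $v_{j'}$ be the element immediately after $v_j$ in $\sigma(f')$, set $\mathbb{C}(v_{j+k})=\mathbb{C}(v_{j+k},v_{j'})$, add an edge from $v_{j'}$ to every element of $\mathbb{C}(v_{j+k},v_{l-2})$, mark all elements of the chain visited, remove its interior from $\sigma(f')$, and set $k=m$. (2) If no edges were added in (1), increase $k$ by $1$. *Phase 2.* Set $\mathcal{A}_{i+1}=\hat{\mathcal{A}}_i$. Process the edges of $\mathcal{S}_{i+1}$ in increasing order of Euclidean length, adding an edge to $\mathcal{A}_{i+1}$ whenever it is not yet present and the result is still a PSLG. The resulting $\mathcal{A}_{i+1}$ is a maximal PSLG of $\mathcal{G}_{i+1}$. *)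

(* Defs.v *)
From HB Require Import structures.
From mathcomp Require Import all_boot all_order all_algebra.
From mathcomp Require Import all_classical all_reals all_analysis.

Set Implicit Arguments.
Unset Strict Implicit.
Unset Printing Implicit Defensive.

Import Order.TTheory GRing.Theory Num.Theory.
Import numFieldNormedType.Exports.

Local Open Scope classical_set_scope.
Local Open Scope ring_scope.

(* A point set is an indexed family p : 'I_n -> R * R.  Vertices are indices, an
   edge is a two-element set of vertices, and a graph is its set of edges.
   Delta = 3 ^ d bounds the diameter, gamma in (1/3, 1) scales the hierarchy of
   grids G_0, ..., G_L with L = log_3 (9 Delta) + 1, and the algorithm builds
   A 0, ..., A L, where hatA i is A i after the first phase at level i. *)

Notation graph n := {set {set 'I_n}}.

Definition dist (R : realType) (x y : R * R) : R :=
  Num.sqrt ((x.1 - y.1) ^+ 2 + (x.2 - y.2) ^+ 2).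

(* Positive iff one turns left at y going from x to y to z. *)
Definition orient (R : realType) (x y z : R * R) : R :=
  (y.1 - x.1) * (z.2 - x.2) - (y.2 - x.2) * (z.1 - x.1).

Definition boundary (T : topologicalType) (A : set T) : set T :=
  closure A `\` A°.

(* The lower bounds of the coordinates are strict because the
   lines x = 0 and y = 0 are grid lines for every gamma. *)
Definition point_set (R : realType) (n d : nat) (p : 'I_n -> R * R) : Prop :=
  [/\ forall u v w : 'I_n, u != v -> v != w -> u != w ->
        orient (p u) (p v) (p w) != 0,
      (forall u v : 'I_n, u != v -> 1 <= dist (p u) (p v)) /\
        (exists u v : 'I_n, u != v /\ dist (p u) (p v) = 1),
      forall u v : 'I_n, dist (p u) (p v) <= 3 ^+ d &
      forall v : 'I_n, [/\ 0 < (p v).1, (p v).1 <= 3 * 3 ^+ d,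
                           0 < (p v).2 & (p v).2 <= 3 * 3 ^+ d]].

(* L = log_3 (9 * 3 ^ d) + 1 *)
Definition top_level (d : nat) : nat := d.+3.

(* gamma * 3 ^ (i - 1) *)
Definition cell_side (R : realType) (gamma : R) (i : nat) : R :=
  gamma * 3 ^+ i / 3.

Definition grid_cell (R : realType) (gamma : R) (i : nat) (c : nat * nat) :
    set (R * R) :=
  let s := cell_side gamma i in
  [set x | [/\ c.1%:R * s <= x.1, x.1 <= c.1.+1%:R * s,
               c.2%:R * s <= x.2 & x.2 <= c.2.+1%:R * s]].

(* The cells of G_i: a square array with 3 ^ (L - i) rows and columns. *)
Definition grid (R : realType) (d : nat) (gamma : R) (i : nat) :
    set (set (R * R)) :=
  [set C | exists c : nat * nat,
     [/\ (c.1 < 3 ^ (top_level d - i))%N, (c.2 < 3 ^ (top_level d - i))%N &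
         C = grid_cell gamma i c]].

Definition off_grid_lines (R : realType) (n d : nat) (p : 'I_n -> R * R)
    (gamma : R) : Prop :=
  forall (i : nat) (C : set (R * R)) (v : 'I_n),
    (i <= top_level d)%N -> grid d gamma i C -> ~ boundary C (p v).

(* For each point set all but finitely many gamma in (1/3, 1) are admissible. *)
Definition admissible (R : realType) (n d : nat) (p : 'I_n -> R * R)
    (gamma : R) : Prop :=
  [/\ 3^-1 < gamma, gamma < 1 & off_grid_lines d p gamma].

Definition cell_nbhd (R : realType) (d : nat) (gamma : R) (i : nat)
    (C : set (R * R)) : set (R * R) :=
  \bigcup_(D in [set D | grid d gamma i D /\ boundary D `&` boundary C !=set0])
    D.

Definition point_nbhd (R : realType) (d : nat) (gamma : R) (i : nat)
    (x : R * R) : set (R * R) :=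
  [set y | exists C, [/\ grid d gamma i C, C x & cell_nbhd d gamma i C y]].

Definition complete_graph (n : nat) : graph n :=
  [set e : {set 'I_n} | #|e| == 2]%SET.

Definition adjacency_graph (R : realType) (n d : nat) (p : 'I_n -> R * R)
    (gamma : R) (i : nat) : graph n :=
  [set e : {set 'I_n} | `[< exists u v : 'I_n,
       [/\ u != v, e = [set u; v]%SET &
           point_nbhd d gamma i (p v) (p u)] >]]%SET.

(* Used only for i > 0. *)
Definition level_edges (R : realType) (n d : nat) (p : 'I_n -> R * R)
    (gamma : R) (i : nat) : graph n :=
  (adjacency_graph d p gamma i :\: adjacency_graph d p gamma i.-1)%SET.

Definition open_segment (R : realType) (x y : R * R) : set (R * R) :=
  [set z | exists t : R, [/\ 0 < t, t < 1 &
     z = (x.1 + t * (y.1 - x.1), x.2 + t * (y.2 - x.2))]].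

Definition edge_interior (R : realType) (n : nat) (p : 'I_n -> R * R)
    (e : {set 'I_n}) : set (R * R) :=
  [set z | exists u v : 'I_n,
     [/\ u != v, e = [set u; v]%SET & open_segment (p u) (p v) z]].

Definition edge_length (R : realType) (n : nat) (p : 'I_n -> R * R)
    (e : {set 'I_n}) : R :=
  \big[Num.max/0]_(u in e) \big[Num.max/0]_(v in e) dist (p u) (p v).

Definition weight (R : realType) (n : nat) (p : 'I_n -> R * R) (E : graph n) :
    R :=
  \sum_(e in E) edge_length p e.

Definition is_pslg (R : realType) (n : nat) (p : 'I_n -> R * R) (E : graph n) :
    Prop :=
  (E \subset complete_graph n)%SET /\
  forall e e' : {set 'I_n}, e \in E -> e' \in E -> e != e' ->
    edge_interior p e `&` edge_interior p e' = set0.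

Definition maximal_pslg (R : realType) (n : nat) (p : 'I_n -> R * R)
    (G E : graph n) : Prop :=
  [/\ is_pslg p E, (E \subset G)%SET &
      forall e : {set 'I_n}, e \in G -> e \notin E ->
        ~ is_pslg p (e |: E)%SET].

Definition triangulation (R : realType) (n : nat) (p : 'I_n -> R * R)
    (E : graph n) : Prop :=
  maximal_pslg p (complete_graph n) E.

Definition min_weight_triangulation (R : realType) (n : nat)
    (p : 'I_n -> R * R) (E : graph n) : Prop :=
  triangulation p E /\
  forall E' : graph n, triangulation p E' -> weight p E <= weight p E'.

Definition pslg_complement (R : realType) (n : nat) (p : 'I_n -> R * R)
    (G : graph n) : set (R * R) :=
  ~` (range p `|` \bigcup_(e in [set e | e \in G]) edge_interior p e).

Definition component_of (T : topologicalType) (A K : set T) : Prop :=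
  exists2 x, A x & K = connected_component A x.

Definition face (R : realType) (n : nat) (p : 'I_n -> R * R) (G : graph n)
    (f : set (R * R)) : Prop :=
  component_of (pslg_complement p G) f.

Definition triangulated_face (R : realType) (n : nat) (p : 'I_n -> R * R)
    (G : graph n) (f : set (R * R)) : Prop :=
  [/\ exists M : R, forall x, f x -> `|x.1| <= M /\ `|x.2| <= M,
      connected (boundary f),
      #|[set e in G | `[< edge_interior p e `<=` boundary f >]]%SET| = 3%N &
      #|[set v | `[< boundary f (p v) >]]%SET| = 3%N].

(* A cyclic sequence of clen elements, indexed by the integers mod clen. *)
Record cycseq (T : Type) := CycSeq { clen : nat; celt :> int -> T }.

Definition is_cycseq (T : Type) (s : cycseq T) : Prop :=
  (0 < clen s)%N /\ forall k : int, s (k + (clen s)%:Z) = s k.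

Definition chain_size (i j : int) : nat := absz (j - i + 1).

(* The cyclic sequence < s_i, s_{i+1}, ..., s_j >, for i <= j. *)
Definition chain (T : Type) (s : cycseq T) (i j : int) : cycseq T :=
  CycSeq (chain_size i j) (fun t => s (i + (t %% (chain_size i j)%:Z)%Z)).

(* The face f lies to the right of the segment directed from x to y. *)
Definition right_of (R : realType) (f : set (R * R)) (x y : R * R) : Prop :=
  forall t : R, 0 < t -> t < 1 ->
    \forall h \near 0^'+,
      f (x.1 + t * (y.1 - x.1) + h * (y.2 - x.2),
         x.2 + t * (y.2 - x.2) - h * (y.1 - x.1)).

(* Rotating counterclockwise about c from the ray to a, one meets the ray to x
   strictly before the ray to b (at a full turn if b = a). *)
Definition ccw_before (R : realType) (n : nat) (p : 'I_n -> R * R)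
    (c a x b : 'I_n) : bool :=
  if a == b then x != a
  else if 0 < orient (p c) (p a) (p b) then
    (0 < orient (p c) (p a) (p x)) && (0 < orient (p c) (p x) (p b))
  else
    (0 < orient (p c) (p a) (p x)) || (0 < orient (p c) (p x) (p b)).

(* A walk with the face on its right that arrives at c from a leaves c along the
   first edge counterclockwise from ca, which is ca itself if c is a leaf. *)
Definition next_vertex (R : realType) (n : nat) (p : 'I_n -> R * R)
    (G : graph n) (a c b : 'I_n) : Prop :=
  [/\ b != c, [set c; b]%SET \in G &
      forall x : 'I_n, x != c -> [set c; x]%SET \in G ->
        ~~ ccw_before p c a x b].

(* s is the vertex sequence of the component K of the boundary of the face f. *)
Definition vertex_sequence (R : realType) (n : nat) (p : 'I_n -> R * R)
    (G : graph n) (f K : set (R * R)) (s : cycseq 'I_n) : Prop :=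
  is_cycseq s /\ component_of (boundary f) K /\
  (clen s = 1%N /\ K = [set p (s 0)] \/
   [/\ forall k : int,
         [/\ s k != s (k + 1), [set s k; s (k + 1)]%SET \in G,
             right_of f (p (s k)) (p (s (k + 1))) &
             next_vertex p G (s k) (s (k + 1)) (s (k + 2))],
       forall k k' : int, 0 <= k -> k < k' -> k' < (clen s)%:Z ->
         (s k, s (k + 1)) != (s k', s (k' + 1)) &
       K = \bigcup_(k in [set: int])
             (p (s k) |` edge_interior p [set s k; s (k + 1)]%SET)]).

Definition has_sequence (R : realType) (n : nat) (p : 'I_n -> R * R)
    (G : graph n) (f : set (R * R)) (s : cycseq 'I_n) : Prop :=
  exists K, vertex_sequence p G f K s.

Definition convex_at (R : realType) (n : nat) (p : 'I_n -> R * R)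
    (s : cycseq 'I_n) (k : int) : Prop :=
  orient (p (s (k - 1))) (p (s k)) (p (s (k + 1))) < 0.

Definition reflex_at (R : realType) (n : nat) (p : 'I_n -> R * R)
    (s : cycseq 'I_n) (k : int) : Prop :=
  ~ convex_at p s k.

Definition reflex_chain (R : realType) (n : nat) (p : 'I_n -> R * R)
    (s : cycseq 'I_n) (i j : int) : Prop :=
  forall t : int, i <= t -> t <= j -> reflex_at p s t.

(* s_i and s_j are visible to each other with respect to f, where j is
   normalized to i < j < i + m.  The second sequence < s_j, ..., s_{i+m} > is the
   rotation of < s_i, s_j, s_{j+1}, ..., s_{i-1} >. *)
Definition visible (R : realType) (n : nat) (p : 'I_n -> R * R)
    (G : graph n) (f : set (R * R)) (s : cycseq 'I_n) (i j : int) : Prop :=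
  let g := open_segment (p (s i)) (p (s j)) in
  let G' : graph n := ([set s i; s j] |: G)%SET in
  [/\ i < j, j < i + (clen s)%:Z, g `<=` f &
      exists f1 f2 : set (R * R),
        [/\ face p G' f1, face p G' f2, f1 <> f2, f `\` g = f1 `|` f2 &
            has_sequence p G' f1 (chain s i j) /\
            has_sequence p G' f2 (chain s j (i + (clen s)%:Z))]].

(* s_c is the forward convex vertex of s_j; the forward support vertex is
   s_{c+1}. *)
Definition forward_convex (R : realType) (n : nat) (p : 'I_n -> R * R)
    (s : cycseq 'I_n) (j c : int) : Prop :=
  [/\ j < c, convex_at p s c &
      forall t : int, j < t -> t < c -> reflex_at p s t].

(* s_c is the backward convex vertex of the reflex s_j; the backward support
   vertex is s_{c-1}. *)
Definition backward_convex (R : realType) (n : nat) (p : 'I_n -> R * R)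
    (s : cycseq 'I_n) (j c : int) : Prop :=
  [/\ reflex_at p s j, c < j, convex_at p s c &
      forall t : int, c < t -> t < j -> reflex_at p s t].

Definition backward_support (R : realType) (n : nat) (p : 'I_n -> R * R)
    (s : cycseq 'I_n) (j : int) : Prop :=
  exists t c : int,
    backward_convex p s t c /\ (c - 1 = j %[mod (clen s)%:Z])%Z.

Definition start_vertex (R : realType) (n : nat) (p : 'I_n -> R * R)
    (s : cycseq 'I_n) (j : int) : Prop :=
  [/\ 0 <= j, j < (clen s)%:Z &
      backward_support p s j \/ (forall t, ~ backward_support p s t) /\ j = 0].

(* A chain ending in the forward support vertex s_l is extended to s_b:
   s_c and s_{c-1} are the backward convex and backward support vertices of
   s_{l+1}, s_r ends the maximal reflex chain starting at s_{l+1}, and s_b is the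
   last element of that chain that sees s_{c-1}, with s_c in its neighborhood. *)
Definition extends_to (R : realType) (n d : nat) (p : 'I_n -> R * R)
    (gamma : R) (i : nat) (G : graph n) (f : set (R * R)) (s : cycseq 'I_n)
    (l b : int) : Prop :=
  exists c r : int,
    let sees (t : int) :=
      point_nbhd d gamma i (p (s t)) (p (s c)) /\ visible p G f s (c - 1) t in
    [/\ backward_convex p s (l + 1) c /\ sees (l + 1),
        reflex_chain p s (l + 1) r /\ ~ reflex_at p s (r + 1),
        l + 1 <= b /\ b <= r,
        sees b &
        forall t : int, b < t -> t <= r -> ~ sees t].

(* pk is the counter k.  pvisited and premoved are unions of residue classes mod
   the length of the sequence; premoved holds the elements that no longer belong
   to the sequence maintained for the shrinking face f'. *)
Record phase1_state (n : nat) := Phase1State {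
  pk : int;
  pvisited : set int;
  premoved : set int;
  padded : graph n }.

Definition elements_between (m : nat) (i j : int) : set int :=
  [set t | exists t' : int, [/\ i <= t', t' <= j & (t = t' %[mod m%:Z])%Z]].

Definition fan (n : nat) (s : cycseq 'I_n) (x i j : int) : graph n :=
  [set e : {set 'I_n} | `[< exists t : int,
       [/\ i <= t, t <= j & e = [set s x; s t]%SET] >]]%SET.

Definition applicable (R : realType) (n d : nat) (p : 'I_n -> R * R)
    (gamma : R) (i : nat) (G : graph n) (f : set (R * R)) (s : cycseq 'I_n)
    (a c : int) : Prop :=
  visible p G f s a (c + 1) /\ point_nbhd d gamma i (p (s a)) (p (s c)).

(* One iteration at s_a, a = j + k, with forward convex vertex s_c and forward
   support vertex s_l, l = c + 1.  In phase1_fan, b = l encodes that the chain is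
   not extended; the second fan is then empty.  The number of edges added is
   counted with one edge per chain element.  In phase1_close, s_j' is the element
   immediately after s_j in the sequence of f'. *)
Inductive phase1_step (R : realType) (n d : nat) (p : 'I_n -> R * R)
    (gamma : R) (i : nat) (G : graph n) (f : set (R * R)) (s : cycseq 'I_n)
    (j : int) (st : phase1_state n) : phase1_state n -> Prop :=
| phase1_no_convex :
    (forall t : int, reflex_at p s t) ->
    phase1_step d p gamma i G f s j st
      (Phase1State (pk st + 1)
        (pvisited st `|` elements_between (clen s) (j + pk st) (j + pk st))
        (premoved st) (padded st))
| phase1_no_edge (c : int) :
    forward_convex p s (j + pk st) c ->
    ~ applicable d p gamma i G f s (j + pk st) c ->
    phase1_step d p gamma i G f s j st
      (Phase1State (pk st + 1)
        (pvisited st `|` elements_between (clen s) (j + pk st) (j + pk st))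
        (premoved st) (padded st))
| phase1_fan (c b : int) :
    let a := j + pk st in
    let l := c + 1 in
    forward_convex p s a c ->
    applicable d p gamma i G f s a c ->
    ~ (pvisited st `|` elements_between (clen s) a a) c ->
    extends_to d p gamma i G f s l b \/
      (forall b' : int, ~ extends_to d p gamma i G f s l b') /\ b = l ->
    phase1_step d p gamma i G f s j st
      (Phase1State
        (pk st + (chain_size a (l - 2))%:Z + (chain_size (l + 1) b)%:Z + 1)
        (pvisited st `|` elements_between (clen s) a b)
        (premoved st `|` elements_between (clen s) (a + 1) (b - 1))
        (padded st :|: fan s l a (l - 2) :|: fan s a (l + 1) b)%SET)
| phase1_close (c j' : int) :
    let a := j + pk st in
    let l := c + 1 in
    let m := (clen s)%:Z in
    forward_convex p s a c ->
    applicable d p gamma i G f s a c ->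
    (pvisited st `|` elements_between (clen s) a a) c ->
    j + m < j' -> ~ premoved st j' ->
    (forall t : int, j + m < t -> t < j' -> premoved st t) ->
    phase1_step d p gamma i G f s j st
      (Phase1State m
        (pvisited st `|` elements_between (clen s) a j')
        (premoved st `|` elements_between (clen s) (a + 1) (j' - 1))
        (padded st :|: fan s j' a (l - 2))%SET).

Inductive phase1_loop (R : realType) (n d : nat) (p : 'I_n -> R * R)
    (gamma : R) (i : nat) (G : graph n) (f : set (R * R)) (s : cycseq 'I_n)
    (j : int) : phase1_state n -> phase1_state n -> Prop :=
| phase1_stop (st : phase1_state n) :
    (clen s)%:Z - 1 < pk st -> phase1_loop d p gamma i G f s j st st
| phase1_iter (st st' st'' : phase1_state n) :
    pk st <= (clen s)%:Z - 1 ->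
    phase1_step d p gamma i G f s j st st' ->
    phase1_loop d p gamma i G f s j st' st'' ->
    phase1_loop d p gamma i G f s j st st''.

(* E is a set of edges that Phase 1 may add for the vertex sequence s of f. *)
Definition phase1_sequence (R : realType) (n d : nat) (p : 'I_n -> R * R)
    (gamma : R) (i : nat) (G : graph n) (f : set (R * R)) (s : cycseq 'I_n)
    (E : graph n) : Prop :=
  exists (j : int) (st : phase1_state n),
    [/\ start_vertex p s j,
        phase1_loop d p gamma i G f s j (Phase1State 0 set0 set0 finset.set0) st &
        E = padded st].

(* Every test made in Phase 1 refers to G and not to the graph under
   construction, so the edges E f K added for the boundary components K of the
   non-triangulated faces f are independent of each other. *)
Definition phase1 (R : realType) (n d : nat) (p : 'I_n -> R * R)
    (gamma : R) (i : nat) (G hatG : graph n) : Prop :=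
  exists E : set (R * R) -> set (R * R) -> graph n,
    (forall f K : set (R * R),
       face p G f -> ~ triangulated_face p G f ->
       component_of (boundary f) K ->
       exists2 s : cycseq 'I_n, vertex_sequence p G f K s &
         phase1_sequence d p gamma i G f s (E f K)) /\
    (forall e : {set 'I_n}, e \in hatG <->
       e \in G \/ exists f K : set (R * R),
         [/\ face p G f, ~ triangulated_face p G f,
             component_of (boundary f) K & e \in E f K]).

Definition greedy_add (R : realType) (n : nat) (p : 'I_n -> R * R)
    (E : graph n) (e : {set 'I_n}) : graph n :=
  if (e \notin E) && `[< is_pslg p (e |: E)%SET >] then (e |: E)%SET else E.

(* r lists the level i+1 edges by increasing length, with ties in any order. *)
Definition phase2 (R : realType) (n d : nat) (p : 'I_n -> R * R)
    (gamma : R) (i : nat) (hatG G' : graph n) : Prop :=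
  exists r : seq {set 'I_n},
    [/\ perm_eq r (enum (level_edges d p gamma i.+1)),
        sorted (fun e e' => edge_length p e <= edge_length p e') r &
        G' = foldl (greedy_add p) hatG r].

Definition algorithm_run (R : realType) (n d : nat) (p : 'I_n -> R * R)
    (gamma : R) (A hatA : nat -> graph n) : Prop :=
  [/\ A 0%N = finset.set0,
      forall i : nat, (i < top_level d)%N ->
        phase1 d p gamma i (A i) (hatA i) /\
        phase2 d p gamma i (hatA i) (A i.+1) &
      hatA (top_level d) = A (top_level d)].

Definition invariant1 (R : realType) (n : nat) (p : 'I_n -> R * R)
    (gamma : R) (i : nat) (A hatA : nat -> graph n) : Prop :=
  is_pslg p (hatA i) /\
  forall e : {set 'I_n}, e \in hatA i -> e \notin A i ->
    edge_length p e <= 4 * Num.sqrt 2 * cell_side gamma i.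

Definition invariant2 (R : realType) (n : nat) (p : 'I_n -> R * R)
    (T : graph n) (gamma : R) (i : nat) (hatA : nat -> graph n) : Prop :=
  (#|[set e in T | (edge_length p e <= cell_side gamma i / Num.sqrt 2)%R]%SET|
     <= #|hatA i|)%N.

Definition approx_mwt (R : realType) (n : nat) (p : 'I_n -> R * R)
    (T : graph n) (alpha : R) (E : graph n) : Prop :=
  triangulation p E /\ weight p E <= alpha * weight p T.

Lemma third_lt1 (R : realType) : 3^-1 < 1 :> R.
Proof. by rewrite invf_lt1 ?ltr1n ?ltr0n. Qed.

(* Main.v *)
Require Import Defs.
From HB Require Import structures.
From mathcomp Require Import all_boot all_order all_algebra.
From mathcomp Require Import all_classical all_reals all_analysis.
From mathcomp Require Import measurable_realfun ring lra.
Import Order.TTheory GRing.Theory Num.Theory.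
Import numFieldNormedType.Exports.
Local Open Scope ring_scope.

(* All triangulations of P have the same number of edges: order P by a linear
   functional that is injective on P and orient the edges from left to right.  At
   each vertex but the last there is one uppermost outgoing edge, and every other
   outgoing edge is the lower side of an empty triangle with the same leftmost
   vertex.  Such a triangle is determined by its middle vertex and by the side of
   that vertex on which its long edge lies, and the pairs that occur depend only
   on P.

   The output A_L is a triangulation by induction on the levels, so |A_L| = |T|,
   and the edges of hatA_i have length at most 4 sqrt 2 s_i, where
   s_i = gamma 3^(i-1).  By Invariant 2 and summation by parts over the levels,
   w(A_L) <= 4 sqrt 2 * sum of s_i(e) over e in T, where i(e) is the least i with
   |e| <= s_i / sqrt 2.  As s_i(e) / sqrt 2 < 3 |e|, the ratio is at most 24.  As
   a function of gamma, s_i(e) / sqrt 2 is K gamma for gamma >= g and 3 K gamma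
   for gamma < g, where |e| = K g and g is in (1/3, 1], so its mean
   K (3 g^2 + 1) / 2 is at most 2 |e|. *)

Set Implicit Arguments.
Unset Strict Implicit.
Unset Printing Implicit Defensive.

(** * Affine functions, barycentric coordinates and segments in the plane *)

Section Plane.
Variable R : realType.
Implicit Types x y z q : R * R.

Definition seg_point (t : R) x y : R * R :=
  (x.1 + t * (y.1 - x.1), x.2 + t * (y.2 - x.2)).

Definition affine (f : R * R -> R) : Prop :=
  forall t x y, f (seg_point t x y) = (1 - t) * f x + t * f y.

Lemma orient_affine u v : affine (orient u v).
Proof. by move=> t x y; rewrite /orient /=; ring. Qed.

Lemma affineB f g a b :
  affine f -> affine g -> affine (fun q => f q * a - g q * b).
Proof. by move=> af ag t x y; rewrite af ag; ring. Qed.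

Lemma orient_cyc x y z : orient x y z = orient y z x.
Proof. by rewrite /orient; ring. Qed.

Lemma orientC x y z : orient x y z = - orient x z y.
Proof. by rewrite /orient; ring. Qed.

Lemma open_segmentC x y z : open_segment x y z -> open_segment y x z.
Proof.
move=> [t [t0 t1 ->]]; exists (1 - t); split; [lra|lra|].
by congr (_, _); ring.
Qed.

Lemma open_segment_orient0 x y z : open_segment x y z -> orient x y z = 0.
Proof. by move=> [t [_ _ ->]]; rewrite /orient /=; ring. Qed.

(** [lc], [la] and [lb] are the barycentric coordinates in the triangle [c a b], as quotients of
    signed areas. The side of a line through two corners is read off one coordinate, and orientation
    about [c] is a determinant in [la] and [lb]. *)
Lemma barycentric c a b : orient c a b != 0 ->
  exists lc la lb : R * R -> R,
    [/\ [/\ affine lc, affine la & affine lb],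
        [/\ lc c = 1, la a = 1 & lb b = 1],
        [/\ la c = 0, lb c = 0, lc a = 0 & lb a = 0] /\ (lc b = 0 /\ la b = 0),
        (forall q, lc q + la q + lb q = 1) /\
        (forall q, q = (lc q * c.1 + la q * a.1 + lb q * b.1,
                        lc q * c.2 + la q * a.2 + lb q * b.2)) &
        [/\ forall q, orient a b q = orient c a b * lc q,
            forall q, orient b c q = orient c a b * la q,
            forall q, orient c a q = orient c a b * lb q &
            forall q q', orient c q q' =
              orient c a b * (la q * lb q' - lb q * la q')]].
Proof.
move=> D0; set D := orient c a b in D0 *.
exists (fun q => orient a b q / D), (fun q => orient b c q / D),
  (fun q => orient c a q / D).
split.
- by split=> t x y; rewrite orient_affine mulrDl !mulrA.
- have Da : orient a b c = D by rewrite -orient_cyc.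
  have Db : orient b c a = D by rewrite -orient_cyc.
  by split; rewrite ?Da ?Db divff.
- split; [split|split]; by rewrite /orient; ring.
- split=> q.
    have -> : 1 = D / D by rewrite divff.
    by rewrite -!mulrDl; congr (_ / _); rewrite /D /orient; ring.
  rewrite [LHS]surjective_pairing.
  have K u v : D * (u / D * v) = u * v by rewrite mulrA (mulrC D) divfK.
  by congr (_, _); apply: (mulfI D0); rewrite !mulrDr !K /D /orient; ring.
- split=> [q|q|q|q q']; try by rewrite mulrC divfK.
  apply: (mulfI D0); have -> u v u' v' :
    D * (D * (u / D * (v / D) - u' / D * (v' / D))) = u * v - u' * v'.
    by field.
  by rewrite /D /orient; ring.
Qed.

(* The first point where a segment starting inside a wedge leaves it. *)
Lemma wedge_exit f g z u : affine f -> affine g -> 0 < f z -> 0 < g z ->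
  (f u <= 0) || (g u <= 0) ->
  exists s : R, [/\ 0 < s, s <= 1 &
    (f (seg_point s z u) = 0 /\ 0 <= g (seg_point s z u)) \/
    (g (seg_point s z u) = 0 /\ 0 <= f (seg_point s z u))].
Proof.
(* The exit point is the zero of [f']; the last inequality says exactly that [g'] is still
   nonnegative there. *)
have exit1 (f' g' : R * R -> R) : affine f' -> affine g' -> 0 < f' z -> 0 < g' z ->
    f' u <= 0 -> f' z * g' u >= g' z * f' u ->
    exists s : R, [/\ 0 < s, s <= 1 &
      f' (seg_point s z u) = 0 /\ 0 <= g' (seg_point s z u)].
  move=> af ag f0 g0 fu h.
  have d0 : 0 < f' z - f' u by lra.
  exists (f' z / (f' z - f' u)); split; first exact: divr_gt0.
    by rewrite ler_pdivrMr //; lra.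
  rewrite af ag; split; first by field; apply/eqP; lra.
  have -> : (1 - f' z / (f' z - f' u)) * g' z + f' z / (f' z - f' u) * g' u =
    (f' z * g' u - g' z * f' u) / (f' z - f' u) by field; apply/eqP; lra.
  by apply: divr_ge0; [rewrite subr_ge0|exact: ltW].
move=> af ag f0 g0 /orP h.
have [l|l] := leP (g z * f u) (f z * g u).
  have fu : f u <= 0.
    case: h => // gu; rewrite -(pmulr_rle0 _ g0); apply: le_trans l _.
    by rewrite pmulr_rle0.
  by have [s [s0 s1 H]] := exit1 f g af ag f0 g0 fu l; exists s; split => //; left.
have gu : g u <= 0.
  case: h => // fu; rewrite -(pmulr_rle0 _ f0); apply: le_trans (ltW l) _.
  by rewrite pmulr_rle0.
have [s [s0 s1 H]] := exit1 g f ag af g0 f0 gu (ltW l).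
by exists s; split => //; right.
Qed.

Lemma seg_point_trans x y z s : open_segment x y z -> 0 < s -> s < 1 ->
  open_segment x y (seg_point s z y).
Proof.
move=> [t [t0 t1 ->]] s0 s1; exists (t + s * (1 - t)); split; [nra|nra|].
by rewrite /seg_point; congr (_, _) => /=; ring.
Qed.

Lemma seg_point1 x y : seg_point 1 x y = y.
Proof. by rewrite [RHS]surjective_pairing; congr (_, _); ring. Qed.

Lemma open_segment_comb x y z (a b : R) : 0 < a -> 0 < b -> a + b = 1 ->
  z = (a * x.1 + b * y.1, a * x.2 + b * y.2) -> open_segment x y z.
Proof.
move=> a0 b0 ab ->; exists b; split; [by []|lra|].
have -> : a = 1 - b by lra.
by congr (_, _); ring.
Qed.

Lemma argmax_ex (I : finType) (P : pred I) (F : I -> R) i0 : P i0 ->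
  exists2 i, P i & forall j, P j -> F j <= F i.
Proof. by move=> Pi0; case: (Order.TotalTheory.arg_maxP F Pi0) => i Pi h; exists i. Qed.

Lemma open_segment_affine0 f x y z : affine f -> open_segment x y z ->
  f x = 0 -> f y = 0 -> f z = 0.
Proof. by move=> af [t [_ _ ->]] fx fy; rewrite [LHS]af fx fy; ring. Qed.

End Plane.

(** * Triangulations *)

Lemma set2_eqP (T : finType) (u v x y : T) :
  [set u; v]%SET = [set x; y]%SET -> (u = x /\ v = y) \/ (u = y /\ v = x).
Proof.
move=> e.
have : u \in [set x; y]%SET by rewrite -e set21.
have : v \in [set x; y]%SET by rewrite -e set22.
have : x \in [set u; v]%SET by rewrite e set21.
have : y \in [set u; v]%SET by rewrite e set22.
rewrite !inE.
by move=> /orP[]/eqP ? /orP[]/eqP ? /orP[]/eqP ? /orP[]/eqP ?; subst; tauto.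
Qed.

Lemma edge_interior_set2 (R : realType) n (p : 'I_n -> R * R) (u v : 'I_n) z :
  u != v -> edge_interior p [set u; v]%SET z <-> open_segment (p u) (p v) z.
Proof.
move=> uv; split=> [[x [y [xy /set2_eqP[[-> ->]|[-> ->]] //]]]|h].
  exact: open_segmentC.
by exists u, v.
Qed.

Section Triangulation.
Variables (R : realType) (n : nat) (p : 'I_n -> R * R) (T : graph n).
Hypothesis general_position : forall u v w : 'I_n, u != v -> v != w -> u != w ->
  orient (p u) (p v) (p w) != 0.
Hypothesis p_inj : injective p.
Hypothesis T_triangulation : triangulation p T.

Definition adj (u v : 'I_n) : bool := [set u; v]%SET \in T.

Lemma adjC u v : adj u v = adj v u.
Proof. by rewrite /adj finset.setUC. Qed.

Lemma adj_neq u v : adj u v -> u != v.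
Proof.
case: T_triangulation => -[/fintype.subsetP sub _] _ _ /sub.
by rewrite inE cards2; case: (u != v).
Qed.

Lemma orient_eq0 u v w : u != v -> orient (p u) (p v) (p w) = 0 -> w = u \/ w = v.
Proof.
move=> uv o; have [->|wu] := eqVneq w u; first by left.
have [->|wv] := eqVneq w v; first by right.
have := general_position uv (_ : v != w) (_ : u != w).
by rewrite o eqxx eq_sym wv eq_sym wu => /(_ isT isT).
Qed.

Lemma vertex_notin_segment u v w : u != v -> ~ open_segment (p u) (p v) (p w).
Proof.
move=> uv h; have := open_segment_orient0 h.
case: h => t [t0 t1 e] /(orient_eq0 uv).
have e1 := congr1 fst e; have e2 := congr1 snd e; rewrite /= in e1 e2.
have K a b : b != 0 -> b * a = 0 -> a = 0 :> R.
  by move=> b0 /eqP; rewrite mulf_eq0 (negbTE b0) => /eqP.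
have tn : t != 0 by rewrite gt_eqF.
have tn1 : 1 - t != 0 by rewrite subr_eq0 eq_sym lt_eqF.
have E : (p u).1 = (p v).1 -> (p u).2 = (p v).2 -> False.
  move=> E1 E2; move/eqP: uv; apply; apply: p_inj.
  by rewrite (surjective_pairing (p u)) E1 E2 -surjective_pairing.
case=> w'; subst w; apply: E; apply/eqP; rewrite -subr_eq0; apply/eqP.
- by apply: (K _ _ tn); lra.
- by apply: (K _ _ tn); lra.
- by apply: (K _ _ tn1); lra.
- by apply: (K _ _ tn1); lra.
Qed.

Lemma adj_cross u v x y z : adj u v -> adj x y ->
  open_segment (p u) (p v) z -> open_segment (p x) (p y) z ->
  [set u; v]%SET = [set x; y]%SET.
Proof.
move=> uv xy h1 h2; case: T_triangulation => -[_ pslg] _ _.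
apply/eqP/negPn/negP => /(pslg _ _ uv xy) e.
have : (set0 : set (R * R)) z; last by [].
by rewrite -e; split; apply/edge_interior_set2 => //; exact: adj_neq.
Qed.

(** This is maximality: if nothing crossed [uv], it could be added to [T]. *)
Lemma not_adj_crossed u v : u != v -> ~~ adj u v ->
  exists x y z, [/\ adj x y, open_segment (p u) (p v) z &
                    open_segment (p x) (p y) z].
Proof.
move=> uv nuv; apply: contrapT => H.
case: T_triangulation => -[sub pslg] _ /(_ [set u; v]%SET); apply => //.
  by rewrite inE cards2 uv.
have pair e : e \in T -> exists x y, e = [set x; y]%SET /\ adj x y.
  move=> eT; have := fintype.subsetP sub _ eT; rewrite inE => /cards2P[x [y [_ E]]].
  by exists x, y; split => //; rewrite /adj -E.
have K e : e \in T ->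
    (edge_interior p [set u; v]%SET `&` edge_interior p e)%classic = classical_sets.set0.
  move=> eT; case: (pair _ eT) => x [y [-> xy]].
  rewrite -subset0 => z [/(edge_interior_set2 _ _ uv) h1].
  move=> /(edge_interior_set2 _ _ (adj_neq xy)) h2.
  by apply: H; exists x, y, z.
split.
  by rewrite finset.subUset sub andbT finset.sub1set inE cards2 uv.
move=> e e'; rewrite !inE => /orP[/eqP->|eT] /orP[/eqP->|e'T]; rewrite ?eqxx // => ne.
- exact: K.
- by rewrite setIC; exact: K.
- exact: pslg.
Qed.

(** Before reaching [u] the meeting point is a common interior point of two edges, so they coincide;
    at [u] itself it would be a vertex inside the edge [xy]. *)
Lemma edge_touch u v x y z s : adj u v -> adj x y -> open_segment (p u) (p v) z ->
  0 < s -> s <= 1 -> open_segment (p x) (p y) (seg_point s z (p u)) ->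
  [set u; v]%SET = [set x; y]%SET.
Proof.
move=> uv xy h s0; rewrite le_eqVlt => /orP[/eqP->|s1] h2.
  by move: h2; rewrite seg_point1 => /(vertex_notin_segment (adj_neq xy)).
apply: (adj_cross uv xy _ h2); apply/open_segmentC/seg_point_trans => //.
exact: open_segmentC.
Qed.

(** An edge from [c] that meets the segment [cw] is collinear with it, so in general position it
    ends at [w] and is [cw] itself. *)
Lemma crossed_endpoint c w x y z : c != w -> ~~ adj c w -> adj x y ->
  open_segment (p c) (p w) z -> open_segment (p x) (p y) z -> x != c.
Proof.
move=> cw ncw xy h1 h2; apply/negP => /eqP xc; subst x.
have := open_segment_orient0 h2; case: h1 => t [t0 _ ->].
have -> : orient (p c) (p y) ((p c).1 + t * ((p w).1 - (p c).1),
  (p c).2 + t * ((p w).2 - (p c).2)) = t * orient (p c) (p y) (p w).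
  by rewrite /orient /=; ring.
move/eqP; rewrite mulf_eq0 gt_eqF //= => /eqP/(orient_eq0 (adj_neq xy))[] E.
  by rewrite E eqxx in cw.
by rewrite E xy in ncw.
Qed.

(* z is the crossing of an edge XY that is nearest to c on some segment cW. The
   edges entering the triangle c z Y must end inside it, so the vertex of this
   triangle with the smallest angle to cz is a neighbor of c. *)
Lemma neighbor_in_triangle c X Y z :
  (forall u v q, adj u v -> open_segment (p u) (p v) q -> ~ open_segment (p c) z q) ->
  (forall w, ~ open_segment (p c) z (p w)) ->
  adj X Y -> open_segment (p X) (p Y) z -> orient (p c) z (p Y) != 0 ->
  exists Q a b, [/\ adj c Q, 0 <= a, 0 < b,
    (p Q).1 - (p c).1 = a * (z.1 - (p c).1) + b * ((p Y).1 - (p c).1) &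
    (p Q).2 - (p c).2 = a * (z.2 - (p c).2) + b * ((p Y).2 - (p c).2)].
Proof.
move=> cz_edge cz_vertex XY zXY D0.
have [lc [la [lb [[ac aa ab] [lcc laa lbb] [[lac lbc lca lba] [lcb lab]]
  [sum1 decomp] [_ _ _ oo]]]]] := barycentric D0.
pose P := [pred q | [&& 0 < lb (p q), 0 <= la (p q) & 0 <= lc (p q)]].
have PY : P Y by rewrite /= lbb lab lcb ltr01 lexx.
have [Q /and3P[lbQ laQ lcQ] Qmax] := argmax_ex (fun q => la (p q) / lb (p q)) PY.
exists Q, (la (p Q)), (lb (p Q)).
have sQ := sum1 (p Q).
have [dQ1 dQ2] : (p Q).1 - (p c).1 =
    la (p Q) * (z.1 - (p c).1) + lb (p Q) * ((p Y).1 - (p c).1) /\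
    (p Q).2 - (p c).2 =
    la (p Q) * (z.2 - (p c).2) + lb (p Q) * ((p Y).2 - (p c).2).
  have d1 := congr1 fst (decomp (p Q)); have d2 := congr1 snd (decomp (p Q)).
  have E : lc (p Q) = 1 - la (p Q) - lb (p Q) by lra.
  by rewrite /= E in d1 d2; rewrite {1}d1 {1}d2; split; ring.
split => //.
have cQ : c != Q by apply/eqP => cQ; move: lbQ; rewrite -cQ lbc ltxx.
apply/negPn/negP => ncQ.
have [u0 [v0 [z' [uv0 cQz' uvz0]]]] := not_adj_crossed cQ ncQ.
(* [h] vanishes on the line [cQ] and is positive on the side of [z]. *)
pose h q := la q * lb (p Q) - lb q * la (p Q).
have ah : affine h by exact: affineB.
have hz' : h z' = 0.
  by apply: (open_segment_affine0 ah cQz'); rewrite /h ?lac ?lbc; ring.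
have [lbz' lcz'] : 0 < lb z' /\ 0 < lc z'.
  case: cQz' => t [t0 t1 ->]; rewrite [lb _]ab [lc _]ac lcc lbc.
  by split; nra.
(* Follow the crossing edge from [z'] to its end on the side of [z]. An end inside the triangle
   would have a smaller angle to [cz] than [Q]. Otherwise the edge leaves through [zY], which is
   part of the edge [XY], or through [cz], which no edge or vertex meets. *)
have core u v : adj u v -> open_segment (p u) (p v) z' -> 0 < h (p u) -> False.
  move=> uv uvz hu.
  have [|] := boolP ((lb (p u) <= 0) || (lc (p u) <= 0)); last first.
    rewrite negb_or -!ltNge => /andP[lbu lcu].
    have lau : 0 < la (p u).
      by rewrite -(pmulr_lgt0 _ lbQ); move: hu; rewrite /h; nra.
    have /Qmax : P u by rewrite /= lbu !ltW.
    rewrite leNgt => /negP; apply.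
    rewrite ltr_pdivrMr // mulrAC ltr_pdivlMr //.
    by move: hu; rewrite /h; nra.
  move=> /(wedge_exit ab ac lbz' lcz')[s [s0 s1 H]].
  set w := seg_point s z' (p u) in H.
  have hw : 0 < h w by rewrite /w ah hz'; nra.
  have sw := sum1 w.
  have dw := decomp w.
  have hit : lc w = 0 -> 0 <= lb w -> False.
    move=> lcw lbw; have law : 0 < la w.
      by rewrite -(pmulr_lgt0 _ lbQ); move: hw; rewrite /h; nra.
    have wXY : open_segment (p X) (p Y) w.
      move: lbw; rewrite le_eqVlt => /orP[/eqP lbw|lbw].
        suff -> : w = z by [].
        rewrite dw lcw -lbw (_ : la w = 1); last lra.
        by rewrite !mul0r !add0r !mul1r !addr0 -surjective_pairing.
      suff -> : w = seg_point (lb w) z (p Y) by apply: seg_point_trans => //; lra.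
      rewrite {1}dw lcw (_ : la w = 1 - lb w); last lra.
      by congr (_, _); ring.
    have lcX : lc (p X) = 0.
      case: zXY => t [t0 t1 zE]; have := lca; rewrite {1}zE [LHS]ac lcb mulr0 addr0.
      by move/eqP; rewrite mulf_eq0 subr_eq0 (gt_eqF t1) => /eqP.
    have lcuv : lc (p u) = 0 /\ lc (p v) = 0.
      by have [[-> ->]|[-> ->]] := set2_eqP (edge_touch uv XY uvz s0 s1 wXY).
    by have := open_segment_affine0 ac uvz lcuv.1 lcuv.2; move: lcz'; lra.
  case: H => -[w0 w1]; last exact: hit.
  have [lcw|lcw] := ltP 0 (lc w); last by apply: hit; lra.
  have law : 0 < la w by move: hw; rewrite /h w0 mul0r subr0 pmulr_lgt0.
  have wcz : open_segment (p c) z w.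
    apply: (open_segment_comb lcw law); first lra.
    by rewrite {1}dw w0 !mul0r !addr0.
  move: s1; rewrite le_eqVlt => /orP[/eqP s1|s1].
    by move: wcz; rewrite /w s1 seg_point1; exact: cz_vertex.
  apply: (cz_edge u v _ uv _ wcz).
  by apply/open_segmentC/seg_point_trans => //; exact: open_segmentC.
have [hu|hu] := ltP 0 (h (p u0)); first exact: (core u0 v0).
have [hv|hv] := ltP 0 (h (p v0)).
  by apply: (core v0 u0) => //; [rewrite adjC|exact: open_segmentC].
have [hu0 hv0] : h (p u0) = 0 /\ h (p v0) = 0.
  (* With neither end on the positive side, both ends lie on the line [cQ], so the crossing edge is
     [cQ] itself. *)
  case: uvz0 hz' => t [t0 t1 ->]; rewrite [h _]ah => e.
  by split; nra.
have onQ x : h (p x) = 0 -> x = c \/ x = Q.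
  move=> hx; apply: (orient_eq0 cQ).
  by rewrite oo -(mulr0 (- orient (p c) z (p Y))) -hx /h; ring.
have := adj_neq uv0; case: (onQ _ hu0) => E1; case: (onQ _ hv0) => E2;
  subst u0 v0; rewrite ?eqxx // => _.
- by rewrite uv0 in ncQ.
- by rewrite adjC uv0 in ncQ.
Qed.

(** Suppose [W] lies outside the half-plane and let [z], on an edge [XY], be the crossing of [cW]
    nearest to [c]. Then [z] is outside too. The neighbors of [c] in the triangles [c z Y] and
    [c z X] are inside, which forces [X] and [Y] inside, although [z] lies between them. *)
Lemma neighbor_halfplane c (l m : R) :
  (forall q, adj c q -> l * (p q).1 + m * (p q).2 <= l * (p c).1 + m * (p c).2) ->
  forall w, l * (p w).1 + m * (p w).2 <= l * (p c).1 + m * (p c).2.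
Proof.
move=> H W; have [->|cW] := eqVneq W c; first by [].
rewrite eq_sym in cW.
have [/H//|ncW] := boolP (adj c W).
(* The parameter along [cW] at which the line through the edge [e] is met; minimizing it gives the
   crossing nearest to [c]. *)
pose tt (e : 'I_n * 'I_n) := orient (p e.1) (p e.2) (p c) /
  (orient (p e.1) (p e.2) (p c) - orient (p e.1) (p e.2) (p W)).
pose P := [pred e : 'I_n * 'I_n | adj e.1 e.2 && `[< exists z,
  open_segment (p c) (p W) z /\ open_segment (p e.1) (p e.2) z >]].
have ttE e t : adj e.1 e.2 -> 0 < t -> t < 1 ->
    open_segment (p e.1) (p e.2) (seg_point t (p c) (p W)) -> t = tt e.
  move=> xy t0 t1 h; have o0 := open_segment_orient0 h.
  have op : open_segment (p c) (p W) (seg_point t (p c) (p W)) by exists t.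
  have xc := crossed_endpoint cW ncW xy op h.
  have yc : e.2 != c.
    by apply: (crossed_endpoint cW ncW _ op (open_segmentC h)); rewrite adjC.
  have oc : orient (p e.1) (p e.2) (p c) != 0.
    by apply/eqP => /(orient_eq0 (adj_neq xy))[] /eqP; rewrite eq_sym;
      [rewrite (negbTE xc)|rewrite (negbTE yc)].
  move: o0; rewrite [LHS]orient_affine /tt => o0.
  set oC := orient _ _ (p c) in oc o0 *; set oW := orient _ _ (p W) in o0 *.
  have d0 : oC - oW != 0.
    apply: contra_neq oc => d0; have e1 : oW = oC by lra.
    by rewrite e1 in o0; lra.
  by apply: (mulIf d0); rewrite divfK //; lra.
have [x0 [y0 [z0 [xy0 h1 h2]]]] := not_adj_crossed cW ncW.
have P0 : P (x0, y0) by rewrite /= xy0; apply/asboolP; exists z0.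
have [[X Y] /andP[/= XY /asboolP[z [cWz XYz]]] emin] :=
  argmax_ex (fun e => - tt e) P0.
have [t [t0 t1 zE]] := cWz.
have tE : t = tt (X, Y) by apply: ttE => //; move: XYz; rewrite zE.
have sub q : open_segment (p c) z q ->
    exists s, [/\ 0 < s, s < t & q = seg_point s (p c) (p W)].
  move=> [s [s0 s1 ->]]; exists (s * t); split; [nra|nra|].
  by rewrite zE /seg_point /=; congr (_, _); ring.
have cz_edge u v q : adj u v -> open_segment (p u) (p v) q ->
    ~ open_segment (p c) z q.
  move=> uv uvq /sub[s [s0 s1 qE]].
  have s1' : s < 1 by lra.
  have sE : s = tt (u, v) by apply: ttE => //=; rewrite -qE.
  have /emin : P (u, v).
    by rewrite /= uv; apply/asboolP; exists q; split => //; exists s.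
  by rewrite -sE -tE; lra.
have cz_vertex w : ~ open_segment (p c) z (p w).
  move=> /sub[s [s0 s1 qE]]; apply: (vertex_notin_segment (w := w) cW).
  by exists s; split => //; lra.
have cont x y : adj x y -> open_segment (p x) (p y) z -> orient (p c) z (p y) != 0.
  move=> xy xyz.
  have -> : orient (p c) z (p y) = t * orient (p c) (p W) (p y).
    by rewrite zE /orient /=; ring.
  apply: mulf_neq0; first by rewrite gt_eqF.
  apply/eqP => /(orient_eq0 cW)[] E; subst y.
    have := crossed_endpoint cW ncW _ cWz (open_segmentC xyz).
    by rewrite adjC eqxx => /(_ xy).
  have Wc : W != c by rewrite eq_sym.
  have nWc : ~~ adj W c by rewrite adjC.
  have := crossed_endpoint Wc nWc _ (open_segmentC cWz) (open_segmentC xyz).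
  by rewrite adjC eqxx => /(_ xy).
have YX : adj Y X by rewrite adjC.
have XYz' := open_segmentC XYz.
have [Q1 [a1 [b1 [cQ1 a10 b10 e11 e12]]]] :=
  neighbor_in_triangle cz_edge cz_vertex XY XYz (cont _ _ XY XYz).
have [Q2 [a2 [b2 [cQ2 a20 b20 e21 e22]]]] :=
  neighbor_in_triangle cz_edge cz_vertex YX XYz' (cont _ _ YX XYz').
pose L (q : R * R) := l * (q.1 - (p c).1) + m * (q.2 - (p c).2).
have LQ1 : a1 * L z + b1 * L (p Y) <= 0.
  have -> : a1 * L z + b1 * L (p Y) = l * ((p Q1).1 - (p c).1) + m * ((p Q1).2 - (p c).2).
    by rewrite e11 e12 /L; ring.
  by have := H _ cQ1; lra.
have LQ2 : a2 * L z + b2 * L (p X) <= 0.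
  have -> : a2 * L z + b2 * L (p X) = l * ((p Q2).1 - (p c).1) + m * ((p Q2).2 - (p c).2).
    by rewrite e21 e22 /L; ring.
  by have := H _ cQ2; lra.
have [r [r0 r1 zr]] := XYz.
have Lz : L z = (1 - r) * L (p X) + r * L (p Y) by rewrite {1}zr /L /=; ring.
have Lz' : L z = t * L (p W) by rewrite {1}zE /L /=; ring.
suff : L z <= 0 by rewrite Lz' pmulr_rle0 // /L; lra.
rewrite leNgt; apply/negP => Lz0.
have LY : L (p Y) <= 0.
  rewrite leNgt; apply/negP => LY; have := mulr_gt0 b10 LY.
  by have := mulr_ge0 a10 (ltW Lz0); lra.
have LX : L (p X) <= 0.
  rewrite leNgt; apply/negP => LX; have := mulr_gt0 b20 LX.
  by have := mulr_ge0 a20 (ltW Lz0); lra.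
by nra.
Qed.

(** * Empty triangles and empty wedges at a vertex *)

Definition empty_triangle c a b : Prop :=
  [/\ adj c a, adj a b, adj b c, 0 < orient (p c) (p a) (p b) &
      forall x, ~ [/\ 0 < orient (p c) (p a) (p x), 0 < orient (p a) (p b) (p x) &
                      0 < orient (p b) (p c) (p x)]].

Definition empty_wedge c a b : Prop := forall x, adj c x ->
  ~ (0 < orient (p c) (p a) (p x) /\ 0 < orient (p c) (p x) (p b)).

Lemma empty_triangle_rot c a b : empty_triangle c a b -> empty_triangle a b c.
Proof.
move=> [ca ab bc o e]; split => //; first by rewrite -orient_cyc.
by move=> x [h1 h2 h3]; apply: (e x).
Qed.

(** The far end of an edge from [c] inside the angle is not in the triangle, hence lies beyond [ab],
    and the edge would cross [ab]. *)
Lemma empty_triangle_wedge c a b : empty_triangle c a b -> empty_wedge c a b.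
Proof.
move=> [ca ab bc o e] x cx [h1 h2].
have h2' : 0 < orient (p b) (p c) (p x) by rewrite orient_cyc.
have D0 : orient (p c) (p a) (p b) != 0 by rewrite gt_eqF.
have [lc [la [lb [[ac aa ab'] [lcc laa lbb] [[lac lbc lca lba] [lcb lab]]
  [sum1 decomp] [oc oa ob _]]]]] := barycentric D0.
have lbx : 0 < lb (p x) by rewrite -(pmulr_rgt0 _ o) -ob.
have lax : 0 < la (p x) by rewrite -(pmulr_rgt0 _ o) -oa.
have lcx : lc (p x) < 0.
  have := e x; rewrite oc; have [//|lcx|lcx] := ltgtP (lc (p x)) 0.
    by case; split => //; rewrite pmulr_rgt0.
  have [] := orient_eq0 (adj_neq ab) (_ : orient (p a) (p b) (p x) = 0).
  - by rewrite oc lcx mulr0.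
  - by move=> E; move: lbx; rewrite E lba ltxx.
  - by move=> E; move: lax; rewrite E lab ltxx.
(* The parameter at which [cx] meets the line [ab], from [lc] being 1 at [c]. *)
pose t := (1 - lc (p x))^-1.
have d0 : 0 < 1 - lc (p x) by lra.
have t0 : 0 < t by rewrite invr_gt0.
have tE : t * lc (p x) = t - 1.
  have : t * (1 - lc (p x)) = 1 by rewrite mulVf // gt_eqF.
  by lra.
have t1 : t < 1 by nra.
set w := seg_point t (p c) (p x).
have cxw : open_segment (p c) (p x) w by exists t.
have lcw : lc w = 0 by rewrite /w ac lcc; lra.
have law : 0 < la w by rewrite /w aa lac; nra.
have lbw : 0 < lb w by rewrite /w ab' lbc; nra.
have sw := sum1 w.
have abw : open_segment (p a) (p b) w.
  apply: (open_segment_comb law lbw); first lra.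
  by rewrite {1}(decomp w) lcw !mul0r !add0r.
have [[E _]|[E _]] := set2_eqP (adj_cross cx ab cxw abw).
  by move: ca; rewrite E => /adj_neq; rewrite eqxx.
by move: bc; rewrite E => /adj_neq; rewrite eqxx.
Qed.

Section Wedge.
Variables (c a b : 'I_n).
Hypothesis cab : 0 < orient (p c) (p a) (p b).
Hypotheses (ca : adj c a) (cb : adj c b) (wedge : empty_wedge c a b).

(** From [z] to [u] the edge does not come closer to the line [ab], so it could leave the angle at
    [c] only through the edges [ca] and [cb], which it cannot meet, or through [c], where it would
    end and be an edge inside the wedge. *)
Lemma wedge_endpoint lc la lb u v z :
  affine lc -> affine la -> affine lb ->
  [/\ la (p c) = 0, la (p b) = 0, lb (p c) = 0 & lb (p a) = 0] ->
  (forall q, lc q + la q + lb q = 1) ->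
  (forall q, q = (lc q * (p c).1 + la q * (p a).1 + lb q * (p b).1,
                  lc q * (p c).2 + la q * (p a).2 + lb q * (p b).2)) ->
  (forall x, adj c x -> ~ (0 < la (p x) /\ 0 < lb (p x))) ->
  adj u v -> open_segment (p u) (p v) z -> 0 < la z -> 0 < lb z -> 0 <= lc z ->
  lc z <= lc (p u) -> 0 < lc (p u) -> 0 < la (p u) /\ 0 < lb (p u).
Proof.
move=> ac aa ab [lac lab lbc lba] sum1 decomp nospoke uv uvz laz lbz lcz lczu lcu.
apply: contrapT => H.
have {}H : (la (p u) <= 0) || (lb (p u) <= 0).
  by apply/negPn; rewrite negb_or -!ltNge; apply/negP => /andP.
have [s [s0 s1 E]] := wedge_exit aa ab laz lbz H.
set w := seg_point s z (p u) in E.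
have lcw : 0 < lc w by rewrite /w ac; nra.
have sw := sum1 w.
have dw := decomp w.
have apex : la w = 0 -> lb w = 0 -> False.
  move=> aw bw; have wc : w = p c.
    by rewrite dw aw bw (_ : lc w = 1); [rewrite !mul0r !addr0 !mul1r -surjective_pairing|lra].
  move: s1; rewrite le_eqVlt => /orP[/eqP s1|s1].
    have uc : u = c by apply: p_inj; rewrite -wc /w s1 seg_point1.
    subst u; apply: (nospoke v uv).
    case: uvz laz lbz => t [t0 t1 ->]; rewrite [la _]aa [lb _]ab lac lbc.
    by rewrite !mulr0 !add0r !pmulr_rgt0.
  apply: (vertex_notin_segment (w := c) (adj_neq uv)).
  by rewrite -wc; apply/open_segmentC/seg_point_trans => //; exact: open_segmentC.
have side x f : affine f -> f (p c) = 0 -> f (p x) = 0 -> 0 < f z -> adj c x ->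
    open_segment (p c) (p x) w -> False.
  move=> af fc fx fz cx cxw.
  have fuv : f (p u) = 0 /\ f (p v) = 0.
    by have [[-> ->]|[-> ->]] := set2_eqP (edge_touch uv cx uvz s0 s1 cxw).
  by move: fz; rewrite (open_segment_affine0 af uvz fuv.1 fuv.2) ltxx.
case: E => -[w0]; rewrite le_eqVlt => /orP[/eqP/esym w1|w1]; try exact: apex.
  apply: (side b la) => //; apply: (open_segment_comb lcw w1); first lra.
  by rewrite {1}dw w0 !mul0r !addr0.
apply: (side a lb) => //; apply: (open_segment_comb lcw w1); first lra.
by rewrite {1}dw w0 !mul0r !addr0.
Qed.

(** Of the vertices in the triangle, let [Q] be farthest from the line [ab]. As [cQ] is no edge, it
    is crossed, and one end of the crossing edge lies at least as far from [ab] as the crossing;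
    this end is in the wedge by [wedge_endpoint], and contradicts the choice of [Q]. Likewise an
    edge crossing [ab] would have an end inside the triangle. *)
Lemma wedge_empty_triangle : empty_triangle c a b.
Proof.
have D0 : orient (p c) (p a) (p b) != 0 by rewrite gt_eqF.
have [lc [la [lb [[ac aa ab'] [lcc laa lbb] [[lac lbc lca lba] [lcb lab]]
  [sum1 decomp] [oc oa ob _]]]]] := barycentric D0.
have nospoke x : adj c x -> ~ (0 < la (p x) /\ 0 < lb (p x)).
  move=> cx [h1 h2]; apply: (wedge cx); split.
    by rewrite ob pmulr_rgt0.
  by rewrite 2!orient_cyc oa pmulr_rgt0.
have endpoint := wedge_endpoint ac aa ab' (And4 lac lab lbc lba) sum1 decomp nospoke.
have empty x : ~ [/\ 0 <= lc (p x), 0 < la (p x) & 0 < lb (p x)].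
  move=> [x1 x2 x3].
  have P0 : [pred x | [&& 0 <= lc (p x), 0 < la (p x) & 0 < lb (p x)]] x.
    by rewrite /= x1 x2 x3.
  have [Q /and3P[lcQ laQ lbQ] Qmax] := argmax_ex (fun q => lc (p q)) P0.
  have cQ : c != Q by apply/eqP => cQ; move: laQ; rewrite -cQ lac ltxx.
  have ncQ : ~~ adj c Q by apply/negP => /nospoke; apply.
  have [u0 [v0 [z [uv0 cQz uvz0]]]] := not_adj_crossed cQ ncQ.
  have lcQ1 : lc (p Q) < 1 by have := sum1 (p Q); lra.
  have [laz lbz lcz] : [/\ 0 < la z, 0 < lb z & lc (p Q) < lc z].
    case: cQz => t [t0 t1 ->]; rewrite -/(seg_point t _ _) aa ab' ac lac lbc lcc.
    by split; [rewrite mulr0 add0r pmulr_rgt0|rewrite mulr0 add0r pmulr_rgt0|nra].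
  have core u v : adj u v -> open_segment (p u) (p v) z -> lc z <= lc (p u) -> False.
    move=> uv uvz lczu.
    have [lau lbu] : 0 < la (p u) /\ 0 < lb (p u).
      by apply: (endpoint u v z) => //; lra.
    have /Qmax : [&& 0 <= lc (p u), 0 < la (p u) & 0 < lb (p u)].
      by rewrite lau lbu !andbT; lra.
    lra.
  have [hu|hu] := leP (lc z) (lc (p u0)); first exact: (core u0 v0).
  have [hv|hv] := leP (lc z) (lc (p v0)).
    by apply: (core v0 u0) => //; [rewrite adjC|exact: open_segmentC].
  case: (uvz0) hu hv => t [t0 t1 ->]; rewrite -/(seg_point t _ _) ac => hu hv.
  by nra.
have a_neq_b : a != b.
  by apply/eqP => E; move: laa; rewrite E lab => /eqP; rewrite eq_sym oner_eq0.
split => //; last 2 first.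
- by rewrite adjC.
- move=> x [h1 h2 h3]; apply: (empty x); move: h1 h2 h3; rewrite oc oa ob.
  by rewrite !pmulr_rgt0 // => h1 h2 h3; split => //; exact: ltW.
apply/negPn/negP => nab.
have [u0 [v0 [z [uv0 abz uvz0]]]] := not_adj_crossed a_neq_b nab.
have [laz lbz lcz] : [/\ 0 < la z, 0 < lb z & lc z = 0].
  case: abz => t [t0 t1 ->]; rewrite -/(seg_point t _ _) aa ab' ac laa lbb lba lab lca lcb.
  by split; lra.
have core u v : adj u v -> open_segment (p u) (p v) z -> 0 < lc (p u) -> False.
  move=> uv uvz lcu.
  have [lau lbu] : 0 < la (p u) /\ 0 < lb (p u).
    by apply: (endpoint u v z) => //; rewrite lcz // ltW.
  by apply: (empty u); split => //; exact: ltW.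
have [hu|hu] := ltP 0 (lc (p u0)); first exact: (core u0 v0).
have [hv|hv] := ltP 0 (lc (p v0)).
  by apply: (core v0 u0) => //; [rewrite adjC|exact: open_segmentC].
have [hu0 hv0] : lc (p u0) = 0 /\ lc (p v0) = 0.
  by case: uvz0 lcz => t [t0 t1 ->]; rewrite -/(seg_point t _ _) ac => e; split; nra.
have onab x : lc (p x) = 0 -> x = a \/ x = b.
  by move=> hx; apply: (orient_eq0 a_neq_b); rewrite oc hx mulr0.
have := adj_neq uv0; case: (onab _ hu0) => E1; case: (onab _ hv0) => E2;
  subst u0 v0; rewrite ?eqxx // => _.
- by rewrite uv0 in nab.
- by rewrite adjC uv0 in nab.
Qed.

End Wedge.

(** * Counting the edges of a triangulation *)

Definition lin (l m : R) (u : 'I_n) : R := l * (p u).1 + m * (p u).2.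

Lemma linN l m u : lin (- l) (- m) u = - lin l m u.
Proof. by rewrite /lin; ring. Qed.

(** The slope of [cx] in the coordinates [l x + m y] and [l y - m x], a rotated and scaled copy of
    the standard ones. *)
Definition slope (l m : R) (c x : 'I_n) : R :=
  (l * ((p x).2 - (p c).2) - m * ((p x).1 - (p c).1)) / (lin l m x - lin l m c).

(** If all neighbors of [v] were in the half-plane to its left, so would be all vertices. *)
Lemma right_neighbor l m v w : lin l m v < lin l m w ->
  exists2 q, adj v q & lin l m v < lin l m q.
Proof.
move=> vw; apply: contrapT => H; move: vw; apply/negP; rewrite -leNgt.
apply: neighbor_halfplane => q vq; rewrite leNgt; apply/negP => h.
by apply: H; exists q.
Qed.

(** [l ^+ 2 + m ^+ 2] is the determinant of the change of coordinates. *)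
Lemma orient_slope l m c x y : lin l m x != lin l m c -> lin l m y != lin l m c ->
  (l ^+ 2 + m ^+ 2) * orient (p c) (p x) (p y) =
  (lin l m x - lin l m c) * (lin l m y - lin l m c) * (slope l m c y - slope l m c x).
Proof.
rewrite -subr_eq0 => x0; rewrite -subr_eq0 => y0; rewrite /slope.
set X := lin l m x - lin l m c in x0 *; set Y := lin l m y - lin l m c in y0 *.
have -> a b : X * Y * (a / Y - b / X) = X * a - b * Y by field; rewrite x0 y0.
by rewrite /X /Y /lin /orient; ring.
Qed.

Section Functional.
Variables l m : R.
Hypothesis lm0 : 0 < l ^+ 2 + m ^+ 2.
Local Notation xi := (lin l m).
Local Notation sl := (slope l m).

Lemma orient_same c x y : xi c < xi x -> xi c < xi y ->
  (0 < orient (p c) (p x) (p y)) = (sl c x < sl c y).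
Proof.
move=> cx cy; rewrite -(pmulr_rgt0 _ lm0) orient_slope ?gt_eqF //.
by rewrite pmulr_rgt0 ?subr_gt0 // mulr_gt0 ?subr_gt0.
Qed.

Lemma orient_same_left c x y : xi x < xi c -> xi y < xi c ->
  (0 < orient (p c) (p x) (p y)) = (sl c x < sl c y).
Proof.
move=> cx cy; rewrite -(pmulr_rgt0 _ lm0) orient_slope ?lt_eqF //.
by rewrite pmulr_rgt0 ?subr_gt0 // nmulr_rgt0 subr_lt0.
Qed.

Lemma orient_right_left c x y : xi c < xi x -> xi y < xi c ->
  (0 < orient (p c) (p x) (p y)) = (sl c y < sl c x).
Proof.
move=> cx cy; rewrite -(pmulr_rgt0 _ lm0) orient_slope; last 2 first.
- by rewrite gt_eqF.
- by rewrite lt_eqF.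
have h : (xi x - xi c) * (xi y - xi c) < 0 by rewrite pmulr_rlt0 ?subr_gt0 ?subr_lt0.
by rewrite nmulr_rgt0 // subr_lt0.
Qed.

Lemma right_extreme c w : xi c < xi w ->
  exists b, [/\ adj c b, xi c < xi b &
    forall x, adj c x -> xi c < xi x -> sl c x <= sl c b].
Proof.
move=> /right_neighbor[q cq q0].
have P0 : [pred x | adj c x && (xi c < xi x)] q by rewrite /= cq.
have [b /andP[cb b0] bmax] := argmax_ex (sl c) P0.
by exists b; split => // x cx x0; apply: bmax; rewrite /= cx.
Qed.

Lemma left_extreme c u : xi u < xi c ->
  exists a, [/\ adj c a, xi a < xi c &
    forall x, adj c x -> xi x < xi c -> sl c a <= sl c x].
Proof.
move=> uc; have : lin (- l) (- m) c < lin (- l) (- m) u by rewrite !linN ltrN2.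
move=> /right_neighbor[q cq]; rewrite !linN ltrN2 => q0.
have P0 : [pred x | adj c x && (xi x < xi c)] q by rewrite /= cq.
have [b /andP[cb b0] bmax] := argmax_ex (fun x => - sl c x) P0.
by exists b; split => // x cx x0; rewrite -lerN2; apply: bmax; rewrite /= cx.
Qed.

(** The uppermost edges at [c] to the right and to the left bound the wedge that contains the upward
    direction. Its angle is less than a half turn because [c] lies below the segment [uw]. *)
Lemma triangle_above c u w : (forall x, x != c -> xi x != xi c) ->
  xi u < xi c -> xi c < xi w ->
  0 < orient (p u) (p c) (p w) ->
  exists a b, [/\ xi a < xi c, xi c < xi b & empty_triangle c b a].
Proof.
move=> inj uc cw ucw.
have [b [cb b0 bmax]] := right_extreme cw.
have [a [ca a0 amin]] := left_extreme uc.
exists a, b; split => //.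
have ab : sl c a < sl c b.
  rewrite ltNge; apply/negP => ba.
  (* Otherwise all neighbors of [c], hence all vertices, lie on or below the line of slope [s]
     through [c], and [u c w] is no left turn. The functional in [K] measures the height over this
     line. *)
  pose s := sl c b.
  have K x : xi x != xi c ->
      - (s * l + m) * (p x).1 + (l - s * m) * (p x).2 -
      (- (s * l + m) * (p c).1 + (l - s * m) * (p c).2) =
      (sl c x - s) * (xi x - xi c).
    move=> x0; rewrite [RHS]mulrBl [sl c x]/slope divfK ?subr_eq0 //.
    by rewrite /lin; ring.
  have H : forall q, adj c q ->
      - (s * l + m) * (p q).1 + (l - s * m) * (p q).2 <=
      - (s * l + m) * (p c).1 + (l - s * m) * (p c).2.
    move=> q cq; rewrite -subr_le0.
    have qc : q != c by rewrite eq_sym; exact: adj_neq.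
    rewrite K ?inj //; have [q0|q0|/eqP] := ltgtP (xi q) (xi c).
    - by rewrite nmulr_lle0 ?subr_lt0 // subr_ge0; apply: le_trans ba (amin _ cq q0).
    - by rewrite pmulr_lle0 ?subr_gt0 // subr_le0; apply: bmax.
    - by rewrite (negbTE (inj _ qc)).
  have Hw := neighbor_halfplane H w; have Hu := neighbor_halfplane H u.
  move: Hw; rewrite -subr_le0 K ?gt_eqF // pmulr_lle0 ?subr_gt0 // subr_le0 => Hw.
  move: Hu; rewrite -subr_le0 K ?lt_eqF // nmulr_lle0 ?subr_lt0 // subr_ge0 => Hu.
  move: ucw; rewrite orient_cyc orient_right_left //.
  by rewrite ltNge (le_trans Hw Hu).
apply: wedge_empty_triangle => //; first by rewrite orient_right_left.
move=> x cx [h1 h2].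
have xc : x != c by rewrite eq_sym; exact: adj_neq.
have [x0|x0|/eqP] := ltgtP (xi x) (xi c); last by rewrite (negbTE (inj _ xc)).
- by move: h2; rewrite orient_same_left // ltNge amin.
- by move: h1; rewrite orient_same // ltNge bmax.
Qed.

(** Both angles contain the upward direction. If the triangles differed, an edge of one would lie
    inside the angle of the other. *)
Lemma triangle_above_uniq c x y x' y' :
  empty_triangle c x y -> empty_triangle c x' y' ->
  xi c < xi x -> xi y < xi c -> xi c < xi x' -> xi y' < xi c -> x = x' /\ y = y'.
Proof.
move=> t t' cx cy cx' cy'.
have core z z' w w' : empty_triangle c z w -> empty_triangle c z' w' ->
    xi c < xi z -> xi w < xi c -> xi c < xi z' -> xi w' < xi c ->
    ~ 0 < orient (p c) (p z) (p z').
  move=> s s' cz cw cz' cw' h.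
  have [cz2 _ _ o _] := s; have [cz'2 _ _ o' _] := s'.
  apply: (empty_triangle_wedge s cz'2); split => //.
  move: o h; rewrite (orient_right_left cz cw) (orient_right_left cz' cw).
  by rewrite (orient_same cz cz'); exact: lt_trans.
have cx0 : c != x by apply: contraTneq cx => ->; rewrite ltxx.
have xx : x = x'.
  apply: contrapT => /eqP xx.
  have cx'0 : c != x' by apply: contraTneq cx' => ->; rewrite ltxx.
  have := general_position cx0 xx cx'0.
  rewrite neq_lt => /orP[|]; last exact: core t t' _ _ _ _.
  by rewrite orientC oppr_lt0; apply: core t' t _ _ _ _.
split => //; apply: contrapT => /eqP yy; subst x'.
have cy0 : c != y by apply: contraTneq cy => ->; rewrite ltxx.
have cy'0 : c != y' by apply: contraTneq cy' => ->; rewrite ltxx.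
have [_ _ yc o _] := t; have [_ _ yc' o' _] := t'.
have := general_position cy0 yy cy'0.
rewrite neq_lt => /orP[|] h.
  apply: (empty_triangle_wedge t (x := y')); first by rewrite adjC.
  by split => //; rewrite orientC oppr_gt0.
by apply: (empty_triangle_wedge t' (x := y)); first by rewrite adjC.
Qed.

End Functional.

Section Count.
Variables l m : R.
Hypothesis lin_inj : injective (lin l m).
Local Notation xi := (lin l m).

Local Lemma lm_gt0 (u v : 'I_n) : u != v -> 0 < l ^+ 2 + m ^+ 2.
Proof.
move=> uv; rewrite lt_neqAle addr_ge0 ?sqr_ge0 // andbT eq_sym.
rewrite paddr_eq0 ?sqr_ge0 // !sqrf_eq0; apply/negP => /andP[/eqP l0 /eqP m0].
by move/eqP: uv; apply; apply: lin_inj; rewrite /lin l0 m0 !mul0r.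
Qed.

Local Lemma xi_neq u v : u != v -> xi u != xi v.
Proof. by apply: contra_neq => /lin_inj. Qed.

Definition arcs : {set 'I_n * 'I_n} :=
  [set e | adj e.1 e.2 && (xi e.1 < xi e.2)]%SET.

Lemma card_arcs : #|arcs| = #|T|.
Proof.
rewrite -(@card_in_imset _ _ (fun e : 'I_n * 'I_n => [set e.1; e.2]%SET)).
  apply: eq_card => e; apply/imsetP/idP => [[[u v]]|eT].
    by rewrite inE => /andP[uv _] ->.
  have [-[/fintype.subsetP/(_ _ eT)]] := T_triangulation.
  rewrite inE => /cards2P[u [v [uv eE]]] _ _ _.
  have auv : adj u v by rewrite /adj -eE.
  have [h|h|h] := ltgtP (xi u) (xi v).
  - by exists (u, v); rewrite // inE auv.
  - by exists (v, u); rewrite ?inE /= 1?adjC ?auv // eE finset.setUC.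
  - by move/lin_inj/eqP: h; rewrite (negbTE uv).
move=> [u v] [u' v']; rewrite !inE /= => /andP[_ h] /andP[_ h'].
by move=> /set2_eqP[[-> ->]//|[E1 E2]]; subst; move: (lt_trans h h'); rewrite ltxx.
Qed.

Definition lower_arcs : {set 'I_n * 'I_n} :=
  [set e in arcs | [exists b, [&& adj e.1 b, xi e.1 < xi b &
     0 < orient (p e.1) (p e.2) (p b)]]]%SET.

Definition non_last : {set 'I_n} := [set v | [exists w, xi v < xi w]]%SET.

(** The bijection sends an arc to its left end. Every vertex but the last has an outgoing edge of
    greatest slope, and by general position only one. *)
Lemma card_upper_arcs : #|(arcs :\: lower_arcs)%SET| = #|non_last|.
Proof.
have upper u v b : (u, v) \in (arcs :\: lower_arcs)%SET -> adj u b -> xi u < xi b ->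
    ~ 0 < orient (p u) (p v) (p b).
  rewrite finset.in_setD => /andP[/negP nlow uv] ub xub o; apply: nlow.
  by rewrite inE uv; apply/existsP; exists b; rewrite /= ub xub.
rewrite -(@card_in_imset _ _ fst).
  apply: eq_card => v; apply/imsetP/idP => [[[u w]]|].
    rewrite finset.in_setD => /andP[_]; rewrite inE => /andP[_ /= uw] ->.
    by rewrite inE; apply/existsP; exists w.
  rewrite inE => /existsP[w vw].
  have vw0 : v != w by apply: contraTneq vw => ->; rewrite ltxx.
  have [b [vb xvb bmax]] := right_extreme vw.
  have vbA : (v, b) \in arcs by rewrite inE /= vb.
  exists (v, b) => //; rewrite finset.in_setD vbA andbT inE vbA /=.
  apply/existsPn => x /=.
  apply/negP => /and3P[vx xvx]; rewrite (orient_same (lm_gt0 vw0)) //.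
  by rewrite ltNge bmax.
move=> [u v] [u' v'] /[dup] h /upper U /[dup] h' /upper U' /= E; subst u'.
congr (_, _); apply: contrapT => /eqP vv.
move: h h'; rewrite !finset.in_setD => /andP[_] + /andP[_]; rewrite !inE /=.
move=> /andP[uv xuv] /andP[uv' xuv'].
have := general_position (adj_neq uv) vv (adj_neq uv').
rewrite neq_lt => /orP[|]; last exact: U.
by rewrite orientC oppr_lt0; exact: U'.
Qed.

Definition triangles : {set 'I_n * 'I_n * 'I_n} :=
  [set t | [&& xi t.1.1 < xi t.1.2, xi t.1.1 < xi t.2 &
              `[< empty_triangle t.1.1 t.1.2 t.2 >]]]%SET.

(** A lower arc corresponds to the triangle that it forms with the next outgoing edge above it. *)
Lemma card_lower_arcs : #|lower_arcs| = #|triangles|.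
Proof.
apply/esym; rewrite -(@card_in_imset _ _ fst).
  apply: eq_card => -[v a]; apply/imsetP/idP => [[[[v' a'] b]]|].
    rewrite inE => /and3P[/= va vb /asboolP[av ab bv o _]] [-> ->].
    rewrite !inE /= av va; apply/existsP; exists b.
    by rewrite adjC bv vb o.
  rewrite !inE /= => /andP[/andP[av va] /existsP[b0 P0]].
  have {}P0 : [pred b | [&& adj v b, xi v < xi b & 0 < orient (p v) (p a) (p b)]] b0.
    exact: P0.
  have [b /and3P[vb xvb o] bmin] := argmax_ex (fun x => - slope l m v x) P0.
  have lm0 := lm_gt0 (adj_neq av).
  exists (v, a, b) => //; rewrite inE /= va xvb; apply/asboolP.
  apply: wedge_empty_triangle => // x vx [h1 h2].
  (* An edge inside the angle of two outgoing edges is outgoing, being a positive combination of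
     them by Cramer's rule. *)
  have xvx : xi v < xi x.
    have e : orient (p v) (p a) (p b) * (xi x - xi v) =
        orient (p v) (p x) (p b) * (xi a - xi v) +
        orient (p v) (p a) (p x) * (xi b - xi v).
      by rewrite /lin /orient; ring.
    rewrite -subr_gt0 -(pmulr_rgt0 _ o) e.
    by apply: addr_gt0; apply: mulr_gt0 => //; rewrite subr_gt0.
  have := bmin x; rewrite /= vx xvx h1 lerN2 => /(_ isT).
  by rewrite leNgt -(orient_same lm0 xvx xvb) h2.
move=> [[v a] b] [[v' a'] b']; rewrite !inE /= => /and3P[va vb /asboolP t].
move=> /and3P[va' vb' /asboolP t'] [E1 E2]; subst v' a'.
congr (_, _); apply: contrapT => /eqP bb.
have [_ _ bv o _] := t; have [_ _ bv' o' _] := t'.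
rewrite adjC in bv; rewrite adjC in bv'.
have := general_position (adj_neq bv) bb (adj_neq bv').
rewrite neq_lt => /orP[|] h.
  by apply: (empty_triangle_wedge t bv'); split => //; rewrite orientC oppr_gt0.
by apply: (empty_triangle_wedge t' bv).
Qed.

(* A triangle is determined by its middle vertex and the side of this vertex on
   which its long edge lies (true: above). *)
Definition middle_sides : {set 'I_n * bool} :=
  [set s | [exists u, exists w, [&& xi u < xi s.1, xi s.1 < xi w &
     if s.2 then 0 < orient (p u) (p s.1) (p w)
     else orient (p u) (p s.1) (p w) < 0]]]%SET.

(** A triangle [(v, a, b)] is listed counterclockwise from its leftmost vertex, so its long edge
    passes above [a] if [a] is in the middle, and below [b] otherwise. *)
Definition middle (t : 'I_n * 'I_n * 'I_n) : 'I_n * bool :=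
  if xi t.1.2 < xi t.2 then (t.1.2, true) else (t.2, false).

Lemma middle_inj : {in triangles &, injective middle}.
Proof.
move=> [[v a] b] [[v' a'] b']; rewrite !inE /= => /and3P[va vb /asboolP t].
move=> /and3P[va' vb' /asboolP t']; rewrite /middle /=.
have nab x y z : empty_triangle x y z -> xi y != xi z.
  by case=> _ /adj_neq/xi_neq.
case: ltgtP (nab _ _ _ t) => // ab _; case: ltgtP (nab _ _ _ t') => // ab' _ [E].
  subst a'; have s := empty_triangle_rot t; have s' := empty_triangle_rot t'.
  have [_ /adj_neq/lm_gt0 lm0 _ _ _] := t.
  by have [-> ->] := triangle_above_uniq lm0 s s' ab va ab' va'.
subst b'; have s := empty_triangle_rot (empty_triangle_rot t).
have s' := empty_triangle_rot (empty_triangle_rot t').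
have [_ /adj_neq/lm_gt0 lm0 _ _ _] := t.
(* A half turn, replacing [l] and [m] by their opposites, exchanges below and above. *)
rewrite -sqrrN -(sqrrN m) in lm0.
by have [||||-> ->] := triangle_above_uniq lm0 s s'; rewrite ?linN ?ltrN2.
Qed.

Lemma card_triangles : #|triangles| = #|middle_sides|.
Proof.
rewrite -(card_in_imset middle_inj); apply: eq_card => -[c s].
apply/imsetP/idP => [[[[v a] b]]|].
  rewrite !inE /= => /and3P[va vb /asboolP[_ /adj_neq/xi_neq ab _ o _]].
  rewrite /middle /=; case: ltgtP ab => // ab _ [-> ->].
    by apply/existsP; exists v; apply/existsP; exists b; rewrite va ab.
  apply/existsP; exists v; apply/existsP; exists a; rewrite /= vb ab /=.
  by rewrite orientC oppr_lt0.
rewrite inE /= => /existsP[u /existsP[w /and3P[uc cw o]]].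
have uw : u != c by apply: contraTneq uc => ->; rewrite ltxx.
have lm0 := lm_gt0 uw.
case: s o => o.
  have [a [b [ac cb t]]] := triangle_above lm0 (fun x => @xi_neq x c) uc cw o.
  exists (a, c, b); last by rewrite /middle /= cb.
  rewrite inE /= ac (lt_trans ac cb); apply/asboolP.
  exact: empty_triangle_rot (empty_triangle_rot t).
rewrite -sqrrN -(sqrrN m) in lm0.
have [||||a [b []]] := triangle_above (c := c) (u := w) (w := u) lm0; rewrite ?linN ?ltrN2 //.
- by move=> x xc; rewrite !linN eqr_opp xi_neq.
- by rewrite orient_cyc orientC oppr_gt0 orient_cyc orient_cyc -orient_cyc orient_cyc.
rewrite ?linN ?ltrN2 => ac cb t; exists (b, a, c).
  by rewrite inE /= (lt_trans cb ac) cb; apply/asboolP; exact: empty_triangle_rot.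
by rewrite /middle /= ltNge ltW.
Qed.

(** Neither [non_last] nor [middle_sides] refers to [T]. *)
Lemma card_triangulation : #|T| = (#|non_last| + #|middle_sides|)%N.
Proof.
rewrite -card_arcs -card_triangles -card_lower_arcs -card_upper_arcs.
rewrite addnC -(cardsID lower_arcs arcs); congr (_ + _)%N.
apply: eq_card => e; rewrite finset.in_setI andb_idl // => h; rewrite inE in h.
by case/andP: h.
Qed.

End Count.

End Triangulation.

Lemma generic_functional (R : realType) n (p : 'I_n -> R * R) : injective p ->
  exists m : R, injective (lin p 1 m).
Proof.
move=> p_inj.
pose F (e : 'I_n * 'I_n) := `|((p e.1).1 - (p e.2).1) / ((p e.1).2 - (p e.2).2)|.
(* The functional identifies two points of distinct ordinates only if [m] is minus a quotient of
   differences; this [m] exceeds them all in absolute value. *)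
exists (1 + \sum_e F e) => u v; rewrite /lin !mul1r => E.
have [y0|y0] := eqVneq ((p u).2 - (p v).2) 0.
  apply: p_inj; rewrite (surjective_pairing (p u)) (surjective_pairing (p v)).
  move/eqP: y0; rewrite subr_eq0 => /eqP y0; rewrite y0 in E *.
  by congr (_, _); lra.
have : F (u, v) <= \sum_e F e.
  by rewrite (bigD1 (u, v)) //= lerDl sumr_ge0 // => e _; exact: normr_ge0.
rewrite /F /= (_ : _ / _ = - (1 + \sum_e F e)).
  rewrite normrN ger0_norm ?addr_ge0 ?sumr_ge0 // => [|e _]; last exact: normr_ge0.
  by move=> ?; exfalso; lra.
by apply: (mulIf y0); rewrite divfK //; lra.
Qed.

Theorem triangulation_card (R : realType) n (p : 'I_n -> R * R) (T T' : graph n) :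
  (forall u v w : 'I_n, u != v -> v != w -> u != w ->
     orient (p u) (p v) (p w) != 0) ->
  injective p -> triangulation p T -> triangulation p T' -> #|T| = #|T'|.
Proof.
move=> gp p_inj tT tT'; have [m lin_inj] := generic_functional p_inj.
by rewrite (card_triangulation gp p_inj tT lin_inj) (card_triangulation gp p_inj tT' lin_inj).
Qed.

(** * The output of the algorithm *)

Section EdgeLength.
Variables (R : realType) (n : nat) (p : 'I_n -> R * R).
Implicit Types (e : {set 'I_n}) (E : graph n).

Lemma edge_length_ge0 e : 0 <= edge_length p e.
Proof. exact: bigmax_ge_id. Qed.

Lemma edge_length_le (M : R) e : 0 <= M ->
  (forall u v, u \in e -> v \in e -> dist (p u) (p v) <= M) -> edge_length p e <= M.
Proof.
by move=> M0 h; apply: bigmax_le => // u ue; apply: bigmax_le => // v; exact: h.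
Qed.

Lemma dist_le_edge_length e u v : u \in e -> v \in e ->
  dist (p u) (p v) <= edge_length p e.
Proof.
move=> ue ve; apply: (Order.TotalTheory.bigmax_sup u) => //.
exact: (Order.TotalTheory.bigmax_sup v).
Qed.

Lemma is_pslg_sub E E' : E \subset E' -> is_pslg p E' -> is_pslg p E.
Proof.
move=> sub [sub' h]; split; first exact: fintype.subset_trans sub sub'.
by move=> e e' /(fintype.subsetP sub) ? /(fintype.subsetP sub) ?; exact: h.
Qed.

Lemma greedy_add_sub E e : E \subset greedy_add p E e.
Proof. by rewrite /greedy_add; case: ifP => // _; exact: finset.subsetUr. Qed.

Lemma greedy_sub r E : E \subset foldl (greedy_add p) E r.
Proof.
elim: r E => //= e r ih E; exact: fintype.subset_trans (greedy_add_sub _ _) (ih _).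
Qed.

Lemma greedy_mem r E e : e \in foldl (greedy_add p) E r -> e \in E \/ e \in r.
Proof.
elim: r E => [|e' r ih] E /=; first by left.
case/ih => [|er]; last by right; rewrite inE er orbT.
rewrite /greedy_add; case: ifP => _; last by left.
by rewrite !inE => /orP[/eqP ->|]; [right; rewrite eqxx|left].
Qed.

(** A conflict met when [e] had its turn persists, because the graph only grows. *)
Lemma greedy_maximal r E e : e \in r -> e \notin foldl (greedy_add p) E r ->
  ~ is_pslg p (e |: foldl (greedy_add p) E r)%SET.
Proof.
elim: r E => // e' r ih E; rewrite inE => /orP[/eqP <-|]; last exact: ih.
move=> /= eE H; have sub := greedy_sub r (greedy_add p E e).
have : e \notin greedy_add p E e by apply: contra eE; exact/fintype.subsetP.
rewrite /greedy_add; case: ifP => [_|+ eE']; first by rewrite !inE eqxx.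
rewrite eE' /= => /asboolP; apply; apply: is_pslg_sub H.
apply: finset.setUS; apply: fintype.subset_trans sub; exact: greedy_add_sub.
Qed.

End EdgeLength.

(** * Grid cells and the lengths of adjacency edges *)

Section Grid.
Variables (R : realType) (n d : nat) (p : 'I_n -> R * R) (gamma : R).
Implicit Types (i : nat) (C : set (R * R)).

Lemma closed_half_planes (a : R) :
  [/\ closed [set x : R * R | a <= x.1]%classic, closed [set x : R * R | x.1 <= a]%classic,
      closed [set x : R * R | a <= x.2]%classic & closed [set x : R * R | x.2 <= a]%classic].
Proof.
have c1 : continuous (fst : R * R -> R) by move=> x; exact: cvg_fst.
have c2 : continuous (snd : R * R -> R) by move=> x; exact: cvg_snd.
split; [apply: (@preimage_closed _ _ fst [set y : R | a <= y]%classic)|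
  apply: (@preimage_closed _ _ fst [set y : R | y <= a]%classic)|
  apply: (@preimage_closed _ _ snd [set y : R | a <= y]%classic)|
  apply: (@preimage_closed _ _ snd [set y : R | y <= a]%classic)].
- by move=> x _; exact: c1.
- exact: closed_ge.
- by move=> x _; exact: c1.
- exact: closed_le.
- by move=> x _; exact: c2.
- exact: closed_ge.
- by move=> x _; exact: c2.
- exact: closed_le.
Qed.

Lemma closed_grid_cell i c : closed (grid_cell gamma i c).
Proof.
set s := cell_side gamma i.
have -> : grid_cell gamma i c =
  ([set x | c.1%:R * s <= x.1] `&` [set x | x.1 <= c.1.+1%:R * s] `&`
   [set x | c.2%:R * s <= x.2] `&` [set x | x.2 <= c.2.+1%:R * s])%classic.
  by apply/seteqP; split=> x /=; [case|case=> -[[]]].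
have [h1 _ _ _] := closed_half_planes (c.1%:R * s).
have [_ h2 _ _] := closed_half_planes (c.1.+1%:R * s).
have [_ _ h3 _] := closed_half_planes (c.2%:R * s).
have [_ _ _ h4] := closed_half_planes (c.2.+1%:R * s).
by do 3!apply: closedI => //.
Qed.

Lemma cell_side_gt0 i : 0 < gamma -> 0 < cell_side gamma i.
Proof. by move=> g0; rewrite /cell_side divr_gt0 // mulr_gt0 // exprn_gt0. Qed.

Lemma cell_sideS i : cell_side gamma i.+1 = 3 * cell_side gamma i.
Proof. by rewrite /cell_side exprS; ring. Qed.

Lemma dist_le_side (x y : R * R) (s : R) : 0 <= s ->
  `|x.1 - y.1| <= 2 * s -> `|x.2 - y.2| <= 2 * s -> dist x y <= 2 * Num.sqrt 2 * s.
Proof.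
move=> s0 h1 h2.
have -> : 2 * Num.sqrt 2 * s = Num.sqrt (8 * s ^+ 2).
  rewrite (_ : 8 * s ^+ 2 = 2 * (2 * s) ^+ 2); last by ring.
  by rewrite sqrtrM // sqrtr_sqr ger0_norm ?mulr_ge0 //; ring.
rewrite /dist ler_wsqrtr //.
have K (a : R) : `|a| <= 2 * s -> a ^+ 2 <= 4 * s ^+ 2.
  move=> h; rewrite -real_normK ?num_real // (_ : 4 * s ^+ 2 = (2 * s) ^+ 2); last by ring.
  by rewrite lerXn2r ?nnegrE ?mulr_ge0.
by have := K _ h1; have := K _ h2; lra.
Qed.

(** The closed cells of the two ends share a point, so each coordinate differs by at most two
    sides. *)
Lemma adjacency_edge_length i e : 0 < gamma -> e \in adjacency_graph d p gamma i ->
  edge_length p e <= 2 * Num.sqrt 2 * cell_side gamma i.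
Proof.
move=> g0; have s0 := ltW (cell_side_gt0 i g0).
rewrite inE => /asboolP[u [v [uv -> [C [[c [_ _ ->]] Cv]]]]].
move=> [D [[c' [_ _ ->]] [z [z1 z2]]] Du].
have bd c0 : boundary (grid_cell gamma i c0) z -> grid_cell gamma i c0 z.
  by move=> [+ _]; rewrite -(proj1 (closure_id _)) //; exact: closed_grid_cell.
move/bd: z1 => {}z1; move/bd: z2 => {}z2.
have duv : dist (p u) (p v) <= 2 * Num.sqrt 2 * cell_side gamma i /\
           dist (p v) (p u) <= 2 * Num.sqrt 2 * cell_side gamma i.
  move: z1 z2 Cv Du => [] + + + + [] + + + + [] + + + + [].
  have S k : k.+1%:R * cell_side gamma i = k%:R * cell_side gamma i + cell_side gamma i.
    by rewrite mulrSr mulrDl mul1r.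
  rewrite !S => *.
  by split; apply: dist_le_side => //; rewrite ler_norml; lra.
have M0 : 0 <= 2 * Num.sqrt 2 * cell_side gamma i.
  by apply: mulr_ge0 => //; apply: mulr_ge0 => //; exact: sqrtr_ge0.
have d0 (x : R * R) : dist x x <= 2 * Num.sqrt 2 * cell_side gamma i.
  by rewrite /dist !subrr expr0n /= addr0 sqrtr0.
apply: edge_length_le => //.
by move=> x y; rewrite !inE => /orP[]/eqP-> /orP[]/eqP->; case: duv.
Qed.

(** A cell is its own neighbor only through a boundary point; this one serves for the top cell. *)
Lemma boundary_corner i : 0 < gamma -> boundary (grid_cell gamma i (0%N, 0%N)) (0, 0).
Proof.
move=> g0; have s0 := cell_side_gt0 i g0; split.
  by apply: subset_closure; split; rewrite /= ?mul0r ?mul1r ?(ltW s0).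
move=> /nbhs_ballP[e /= e0 /(_ (- (e / 2), 0))] H.
have : grid_cell gamma i (0%N, 0%N) (- (e / 2), 0).
  apply: H; split; rewrite /ball /= ?subrr ?normr0 // opprK add0r ger0_norm.
    by rewrite ltr_pdivrMr // ltr_pMr // ltr1n.
  by rewrite divr_ge0 // ltW.
by case; rewrite /= mul0r oppr_ge0 leNgt divr_gt0.
Qed.

(** For [gamma] above 1/3 the single top cell, of side [9 * gamma * 3 ^+ d], contains all of the
    points. *)
Lemma adjacency_top : point_set d p -> 3^-1 < gamma ->
  complete_graph n \subset adjacency_graph d p gamma (top_level d).
Proof.
move=> [_ _ _ box] g3; have g0 : 0 < gamma by apply: lt_trans g3; rewrite invr_gt0.
apply/fintype.subsetP => e; rewrite inE => /cards2P[u [v [uv ->]]].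
rewrite inE; apply/asboolP; exists u, v; split => //.
pose C := grid_cell gamma (top_level d) (0%N, 0%N).
have gC : grid d gamma (top_level d) C by exists (0%N, 0%N); rewrite subnn.
have inC w : C (p w).
  have side : 3 * 3 ^+ d <= cell_side gamma (top_level d).
    rewrite /cell_side !exprS; have h : (0 : R) < 3 ^+ d by rewrite exprn_gt0.
    have : 3^-1 * 3 ^+ d <= gamma * 3 ^+ d by rewrite ler_pM2r // ltW.
    by lra.
  have [x0 x1 y0 y1] := box w.
  split; rewrite /= ?mul0r ?mulr1n ?mul1r ?(ltW x0) ?(ltW y0) //.
  - exact: le_trans x1 side.
  - exact: le_trans y1 side.
exists C; split => //; exists C; last exact: inC.
by split => //; exists (0, 0); split; exact: boundary_corner.
Qed.

End Grid.

(** * Edge lengths, maximality and weight along a run *)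

Section Run.
Variables (R : realType) (n d : nat) (p : 'I_n -> R * R) (T : graph n) (gamma : R).
Variables (A hatA : nat -> graph n).
Hypotheses (hP : point_set d p) (hT : triangulation p T) (gamma3 : 3^-1 < gamma)
  (gamma1 : gamma < 1) (hrun : algorithm_run d p gamma A hatA)
  (hinv1 : forall i, (i <= top_level d)%N -> invariant1 p gamma i A hatA)
  (hinv2 : forall i, (i <= top_level d)%N -> invariant2 p T gamma i hatA).
Local Notation L := (top_level d).
Local Notation s := (cell_side gamma).

Local Lemma gamma_gt0 : 0 < gamma.
Proof. by apply: lt_trans gamma3; rewrite invr_gt0. Qed.

Local Lemma s_gt0 i : 0 < s i.
Proof. exact: cell_side_gt0 gamma_gt0. Qed.

Lemma run_sub_hat i : (i <= L)%N -> A i \subset hatA i.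
Proof.
case: hrun => _ step last; rewrite leq_eqVlt => /orP[/eqP->|iL]; first by rewrite last.
apply/fintype.subsetP => e eA; have [[E [_ H]] _] := step i iL.
by apply/H; left.
Qed.

Lemma hat_sub_run i : (i < L)%N -> hatA i \subset A i.+1.
Proof.
by case: hrun => _ step _ /step[_ [r [_ _ ->]]]; exact: greedy_sub.
Qed.

Lemma hat_sub i j : (i <= j)%N -> (j <= L)%N -> hatA i \subset hatA j.
Proof.
elim: j => [|j ih]; first by rewrite leqn0 => /eqP->.
rewrite leq_eqVlt => /orP[/eqP->//|]; rewrite ltnS => ij jL.
apply: fintype.subset_trans (ih ij (ltnW jL)) _.
exact: fintype.subset_trans (hat_sub_run jL) (run_sub_hat jL).
Qed.

Lemma run_step i e : (i < L)%N -> e \in A i.+1 ->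
  e \in hatA i \/ e \in level_edges d p gamma i.+1.
Proof.
case: hrun => _ step _ /step[_ [r [/perm_mem er _ ->]]] /greedy_mem[|]; first by left.
by rewrite er mem_enum; right.
Qed.

(** The edges of Phase 1 satisfy the bound of the next level since 4 is at most 2 times 3; those of
    Phase 2 are adjacency edges. *)
Lemma run_edge_length i e : (i <= L)%N -> e \in A i ->
  edge_length p e <= 2 * Num.sqrt 2 * s i.
Proof.
elim: i => [|i ih] iL; first by case: hrun => -> _ _; rewrite inE.
have r2 : 0 < Num.sqrt 2 * s i by rewrite mulr_gt0 ?sqrtr_gt0 ?s_gt0.
rewrite cell_sideS; case/(run_step iL) => [ehat|].
  have [eA|eA] := boolP (e \in A i).
    by apply: le_trans (ih (ltnW iL) eA) _; lra.
  have [_ /(_ e ehat eA) h] := hinv1 (ltnW iL).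
  by apply: le_trans h _; lra.
rewrite inE => /andP[_ /(adjacency_edge_length gamma_gt0)].
by rewrite cell_sideS.
Qed.

Lemma hat_edge_length i e : (i <= L)%N -> e \in hatA i ->
  edge_length p e <= 4 * Num.sqrt 2 * s i.
Proof.
move=> iL ehat; have [eA|eA] := boolP (e \in A i).
  apply: le_trans (run_edge_length iL eA) _.
  by have : 0 < Num.sqrt 2 * s i; [rewrite mulr_gt0 ?sqrtr_gt0 ?s_gt0|lra].
by have [_ /(_ e ehat eA)] := hinv1 iL.
Qed.

Lemma complete_edge_length e : e \in complete_graph n ->
  1 <= edge_length p e /\ edge_length p e <= 3 ^+ d.
Proof.
case: hP => _ [far _] diam _; rewrite inE => /cards2P[u [v [uv ->]]]; split.
  apply: le_trans (far u v uv) _; apply: dist_le_edge_length; [exact: set21|exact: set22].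
by apply: edge_length_le => // x y _ _; exact: diam.
Qed.

Lemma adjacency_complete i : adjacency_graph d p gamma i \subset complete_graph n.
Proof.
apply/fintype.subsetP => e; rewrite inE => /asboolP[u [v [uv -> _]]].
by rewrite inE cards2 uv.
Qed.

Lemma run_maximal i e : (i <= L)%N -> e \in adjacency_graph d p gamma i ->
  e \notin A i -> ~ is_pslg p (e |: A i)%SET.
Proof.
elim: i e => [|i ih] e iL eG eA.
  (* At level 0 there is no edge: its length would be at most [2 * Num.sqrt 2 * gamma / 3], which is
     less than 1. *)
  have [h _] := complete_edge_length (fintype.subsetP (adjacency_complete _) _ eG).
  have := adjacency_edge_length gamma_gt0 eG.
  rewrite /cell_side expr0 mulr1 => h2 _.
  have r2 : Num.sqrt 2 <= 3 / 2 :> R.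
    rewrite -(ler_pXn2r (n := 2)) ?nnegrE ?sqrtr_ge0 ?divr_ge0 //.
    by rewrite sqr_sqrtr // expr_div_n ler_pdivlMr ?exprn_gt0 // -!natrX -natrM ler_nat.
  have r0 : 0 <= Num.sqrt 2 :> R by exact: sqrtr_ge0.
  have g0 := gamma_gt0.
  have h3 : Num.sqrt 2 * gamma <= 3 / 2 * gamma by rewrite ler_pM2r.
  set x := Num.sqrt 2 * gamma in h3.
  have h4 : edge_length p e <= 2 / 3 * x.
    by apply: le_trans h2 _; rewrite le_eqVlt /x; apply/orP; left; apply/eqP; field.
  clearbody x; have g1 := gamma1; have h6 : x < 3 / 2 by lra.
  by lra.
have [eG'|eG'] := boolP (e \in adjacency_graph d p gamma i).
  have sub : A i \subset A i.+1.
    exact: fintype.subset_trans (run_sub_hat (ltnW iL)) (hat_sub_run iL).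
  have eA' : e \notin A i by apply: contra eA; exact/fintype.subsetP.
  by move=> H; apply: (ih e (ltnW iL) eG' eA'); apply: is_pslg_sub H; exact: finset.setUS.
have eS : e \in level_edges d p gamma i.+1 by rewrite inE eG eG'.
case: hrun eA => _ step _; have [_ [r [/perm_mem er _ ->]]] := step i iL.
by apply: greedy_maximal; rewrite er mem_enum.
Qed.

Lemma output_triangulation : triangulation p (A L).
Proof.
have LL : (L <= L)%N by [].
have [pslg _] := hinv1 LL; case: (hrun) => _ _ last; rewrite last in pslg.
split=> //; first by case: pslg.
by move=> e /(fintype.subsetP (adjacency_top hP gamma3)); exact: run_maximal.
Qed.

(* [rounded l / sqrt 2] is the least of the thresholds [s i / sqrt 2] that is at
   least [l], in a form that is linear in indicators of levels. *)
Definition rounded (l : R) : R :=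
  s L - \sum_(i < L) (s i.+1 - s i) * (l <= s i / Num.sqrt 2)%R%:R.

Lemma s_le i j : (i <= j)%N -> s i <= s j.
Proof.
move=> ij; rewrite /cell_side ler_pM2r ?invr_gt0 // ler_pM2l ?gamma_gt0 //.
by rewrite ler_weXn2l // ler1n.
Qed.

(** From level [k] on all indicators are 1, and these terms telescope to [s k]; the remaining ones
    only decrease the value. *)
Lemma rounded_le k l : (k <= L)%N -> l <= s k / Num.sqrt 2 -> rounded l <= s k.
Proof.
move=> + hk; rewrite /rounded; elim: L => [|j ih].
  rewrite leqn0 => /eqP->; rewrite big_ord0 subr0 //.
have ge0 m : 0 <= \sum_(i < m) (s i.+1 - s i) * (l <= s i / Num.sqrt 2)%R%:R.
  by apply: sumr_ge0 => i _; rewrite mulr_ge0 // subr_ge0 s_le.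
rewrite leq_eqVlt => /orP[/eqP->|]; first by rewrite gerBl.
rewrite ltnS => kj; rewrite big_ord_recr /=.
have -> : l <= s j / Num.sqrt 2.
  by apply: le_trans hk _; rewrite ler_pM2r ?s_le // invr_gt0 sqrtr_gt0.
by rewrite mulr1; have := ih kj; lra.
Qed.

(** As [hatA] increases, the sum telescopes and the right-hand side is the bound of the first level
    at which [e] occurs. *)
Lemma hat_rounded j e : (j <= L)%N -> e \in hatA j -> edge_length p e <=
  4 * Num.sqrt 2 * (s j - \sum_(i < j) (s i.+1 - s i) * (e \in hatA i)%:R).
Proof.
elim: j => [|j ih] jL eh.
  by rewrite big_ord0 subr0; exact: hat_edge_length.
rewrite big_ord_recr /=; have [ej|ej] := boolP (e \in hatA j).
  rewrite mulr1; apply: le_trans (ih (ltnW jL) ej) _; rewrite le_eqVlt; apply/orP; left;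
    apply/eqP; ring.
rewrite mulr0 big1 => [|i _]; first by rewrite addr0 subr0; exact: hat_edge_length.
rewrite (negbTE (_ : e \notin hatA i)) ?mulr0 //.
by apply: contra ej; apply/fintype.subsetP/hat_sub; exact: ltnW.
Qed.

Lemma p_injective : injective p.
Proof.
case: hP => _ [far _] _ _ u v uv; apply: contrapT => /eqP/far.
by rewrite uv /dist !subrr expr0n /= addr0 sqrtr0 leNgt ltr01.
Qed.

Lemma card_output : #|A L| = #|T|.
Proof.
case: (hP) => gp _ _ _.
exact: triangulation_card gp p_injective output_triangulation hT.
Qed.

Lemma sum_indicator (E F : graph n) : F \subset E ->
  \sum_(e in E) (e \in F)%:R = #|F|%:R :> R.
Proof.
move=> FE; rewrite -natr_sum -sum1_card big_mkcond [in RHS]big_mkcond /=.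
congr (_%:R); apply: eq_bigr => e _; case: ifP => //.
by move=> /negbT eE; rewrite (negbTE (contra (fintype.subsetP FE e) eE)).
Qed.

Lemma weight_output : weight p (A L) <=
  4 * Num.sqrt 2 * \sum_(e in T) rounded (edge_length p e).
Proof.
have [_ _ last] := hrun.
(* Exchanging the sums leaves one cardinality per level. The leading terms then agree since [A L]
   and [T] have equally many edges, and Invariant 2 compares the others. *)
have levels (E : graph n) (F : nat -> graph n) : (forall i, (i <= L)%N -> F i \subset E) ->
  \sum_(e in E) (s L - \sum_(i < L) (s i.+1 - s i) * (e \in F i)%:R) =
  #|E|%:R * s L - \sum_(i < L) (s i.+1 - s i) * #|F i|%:R.
  move=> FE; rewrite sumrB sumr_const exchange_big; congr (_ - _); first by rewrite mulr_natl.
  apply: eq_bigr => i _; rewrite -mulr_sumr sum_indicator //.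
  by apply: FE; exact: ltnW.
pose short i := [set e in T | (edge_length p e <= s i / Num.sqrt 2)%R]%SET.
have -> : \sum_(e in T) rounded (edge_length p e) = #|T|%:R * s L -
    \sum_(i < L) (s i.+1 - s i) * #|short i|%:R.
  rewrite -(levels T short) => [|i _]; last first.
    by apply/fintype.subsetP => e; rewrite inE => /andP[].
  apply: eq_bigr => e eT; congr (_ - _); apply: eq_bigr => i _.
  by rewrite inE eT.
have r0 : 0 <= 4 * Num.sqrt 2 :> R by rewrite mulr_ge0 ?sqrtr_ge0.
apply: (@le_trans _ _ (4 * Num.sqrt 2 *
    \sum_(e in A L) (s L - \sum_(i < L) (s i.+1 - s i) * (e \in hatA i)%:R))).
  rewrite mulr_sumr; apply: ler_sum => e eA; apply: hat_rounded => //.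
  by rewrite last.
rewrite ler_wpM2l // levels => [|i iL]; last by rewrite -last hat_sub.
rewrite card_output lerB //; apply: ler_sum => i _.
rewrite ler_wpM2l ?subr_ge0 ?s_le // ler_nat.
by apply: hinv2; exact: ltnW.
Qed.

End Run.

(** * The rounded length as a function of [gamma] *)

Definition step_slope (R : realType) (K g0 gamma : R) : R :=
  K * `|gamma| * (if g0 <= gamma then 1 else 3).

Lemma sqrt2_bounds (R : realType) : 1 <= Num.sqrt 2 :> R /\ Num.sqrt 2 <= 2 :> R.
Proof.
have r0 := sqrtr_ge0 (2 : R).
have r2 : Num.sqrt 2 ^+ 2 = 2 :> R by rewrite sqr_sqrtr.
by split; nra.
Qed.

(** [K j] is the threshold of level [j] at [gamma = 1], and [j] is the least level with [l <= K j].
    For [gamma >= l / K j] level [j] still suffices; below that, level [j + 1] does, as its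
    threshold [3 * K j * gamma] exceeds [K j]. *)
Lemma rounded_step_slope (R : realType) (d : nat) (l : R) : 1 <= l -> l <= 3 ^+ d ->
  exists K g0 : R, [/\ 0 < K, 3^-1 < g0, g0 <= 1, l = K * g0 &
    forall gamma, 3^-1 < gamma -> gamma < 1 ->
      rounded d gamma l <= Num.sqrt 2 * step_slope K g0 gamma].
Proof.
move=> l1 ld; have [r1 r2] := sqrt2_bounds R.
have r0 : 0 < Num.sqrt 2 :> R by lra.
pose K j : R := 3 ^+ j / 3 / Num.sqrt 2.
have K0 j : 0 < K j by rewrite /K !divr_gt0 // exprn_gt0.
have KS j : K j.+1 = 3 * K j by rewrite /K exprS; ring.
(* Reaching [l] by level [d.+2] keeps level [j.+1] within [top_level d]. *)
have K_top : l <= K d.+2.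
  apply: le_trans ld _; rewrite ler_pdivlMr // !exprS.
  have h : (0 : R) < 3 ^+ d by rewrite exprn_gt0.
  by have := mulr_gt0 h r0; nra.
have exK : exists j, l <= K j by exists d.+2.
have [j lj jmin] := ex_minnP exK.
have j_le : (j <= d.+2)%N by exact: jmin.
have lj3 : K j < 3 * l.
  case: j lj jmin {j_le} => [|j] lj jmin.
    have : K 0%N <= 1 by rewrite /K expr0 ler_pdivrMr // mul1r; lra.
    by lra.
  rewrite KS ltr_pM2l // ltNge; apply/negP => /jmin.
  by rewrite ltnn.
exists (K j), (l / K j); split => //.
- by rewrite ltr_pdivlMr //; lra.
- by rewrite ler_pdivrMr // mul1r.
- by rewrite mulrCA divff ?mulr1 // gt_eqF.
move=> gamma g3 g1; have g0 : 0 < gamma by apply: lt_trans g3; rewrite invr_gt0.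
have sK i : cell_side gamma i = Num.sqrt 2 * (K i * gamma).
  by rewrite /cell_side /K; field; rewrite gt_eqF.
have sK' i : cell_side gamma i / Num.sqrt 2 = K i * gamma.
  by rewrite sK mulrC mulKf // gt_eqF.
rewrite /step_slope gtr0_norm //; case: ifP => h.
  rewrite mulr1 -sK; apply: rounded_le => //; first exact: leqW.
  by rewrite sK' mulrC -ler_pdivrMr.
rewrite [leRHS](_ : _ = cell_side gamma j.+1); last by rewrite sK KS; ring.
apply: rounded_le => //.
by rewrite sK' KS; have := K0 j; nra.
Qed.

(** * Exceptional values of [gamma] *)

Section Admissible.
Variables (R : realType) (n d : nat) (p : 'I_n -> R * R).

(** Off the grid lines the four inequalities that define the cell are strict and persist nearby. *)
Lemma boundary_grid_cell (gamma : R) i c z : boundary (grid_cell gamma i c) z ->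
  exists k : nat, z.1 = k%:R * cell_side gamma i \/ z.2 = k%:R * cell_side gamma i.
Proof.
move=> [zC zI]; apply: contrapT => H; apply: zI.
move: zC; rewrite -(proj1 (closure_id _)); last exact: closed_grid_cell.
set s := cell_side gamma i in H *; case=> x1 x2 y1 y2.
have N1 k : z.1 != k%:R * s by apply/eqP => e; apply: H; exists k; left.
have N2 k : z.2 != k%:R * s by apply/eqP => e; apply: H; exists k; right.
have near1 : nbhs z.1 [set x : R | c.1%:R * s <= x <= c.1.+1%:R * s]%classic.
  near=> x; apply/andP; split; apply: ltW; near: x.
    by apply: lt_nbhsr; rewrite lt_neqAle x1 eq_sym N1.
  by apply: lt_nbhsl; rewrite lt_neqAle x2 N1.
have near2 : nbhs z.2 [set y : R | c.2%:R * s <= y <= c.2.+1%:R * s]%classic.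
  near=> x; apply/andP; split; apply: ltW; near: x.
    by apply: lt_nbhsr; rewrite lt_neqAle y1 eq_sym N2.
  by apply: lt_nbhsl; rewrite lt_neqAle y2 N2.
exists ([set x | c.1%:R * s <= x <= c.1.+1%:R * s],
        [set y | c.2%:R * s <= y <= c.2.+1%:R * s])%classic; first by split.
by move=> [x y] [/= /andP[? ?] /andP[? ?]].
Unshelve. all: by end_near.
Qed.

(** The endpoints of the interval, and the solutions [gamma] of the equations that put a coordinate
    of a point on the [k]-th line of level [i]. *)
Definition exceptional (q : bool + 'I_n * nat * nat * bool) : R :=
  match q with
  | inl true => 3^-1
  | inl false => 1
  | inr (v, k, i, b) => (if b then (p v).1 else (p v).2) / (k%:R * (3 ^+ i / 3))
  end.

Lemma countable_exceptional : countable (range exceptional).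
Proof. exact: (sub_countable (card_image_le _ _)). Qed.

Lemma measurable_exceptional : measurable (range exceptional : set R).
Proof.
have -> : range exceptional = (\bigcup_q [set exceptional q])%classic.
  apply/seteqP; split=> [x [q _ <-]|x [q _ ->]]; first by exists q.
  by exists q.
exact: countable_bigcupT_measurable.
Qed.

Lemma admissibleP (gamma : R) : point_set d p -> 3^-1 <= gamma -> gamma <= 1 ->
  ~ range exceptional gamma -> admissible d p gamma.
Proof.
move=> [_ _ _ box] g3 g1 ex.
have g3' : 3^-1 < gamma.
  by rewrite lt_neqAle g3 andbT; apply/eqP => e; apply: ex; exists (inl true).
have g1' : gamma < 1.
  by rewrite lt_neqAle g1 andbT; apply/eqP => e; apply: ex; exists (inl false).
split=> // i C v _ [c [_ _ ->]] /boundary_grid_cell[k H].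
have [x0 _ y0 _] := box v.
have g0 : gamma != 0 by rewrite gt_eqF // (lt_trans _ g3') // invr_gt0.
have s0 : 3 ^+ i / 3 != 0 :> R by rewrite gt_eqF // divr_gt0 // exprn_gt0.
have K (x : R) : 0 < x -> x = k%:R * cell_side gamma i -> gamma = x / (k%:R * (3 ^+ i / 3)).
  (* The line [k = 0] is excluded by the strict positivity of the coordinates. *)
  move=> x0' xE; have k0 : k%:R != 0 :> R.
    by apply: contraTneq x0' => k0; rewrite xE k0 mul0r ltxx.
  have d0 : k%:R * (3 ^+ i / 3) != 0 :> R by rewrite mulf_neq0.
  by apply: (mulIf d0); rewrite divfK // xE /cell_side; ring.
apply: ex; case: H => H; [exists (inr (v, k, i, true))|exists (inr (v, k, i, false))] => //=;
  by rewrite -K.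
Qed.

End Admissible.

(** * Expectation over gamma *)

Section Integral.
Context (R : realType).
Local Notation mu := (@lebesgue_measure R).
Local Open Scope ereal_scope.

(* Without measurability of f the integral is a lower integral, which is monotone. *)
Lemma ge0_le_integral_lower d (X : measurableType d) (P : {measure set X -> \bar R})
    (f g : X -> \bar R) : (forall x, 0 <= f x) -> (forall x, f x <= g x) ->
  \int[P]_x f x <= \int[P]_x g x.
Proof.
move=> f0 fg; have g0 x : 0 <= g x by exact: le_trans (f0 x) (fg x).
rewrite !ge0_integralTE //; apply: le_ereal_sup => _ [h /= hf <-].
by exists h => // x; exact: le_trans (hf x) (fg x).
Qed.

Lemma integral_linear (a b c : R) : (a <= b)%R ->
  \int[mu]_(x in `[a, b]) (c * x)%:E = (c * (b ^+ 2 - a ^+ 2) / 2)%:E.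
Proof.
rewrite le_eqVlt => /orP[/eqP <-|ab].
  by rewrite set_itv1 integral_set1 subrr mulr0 mul0r.
pose F : R -> R := ((c / 2) \*: ((@id R) ^+ 2))%R.
have dF (x : R) : is_derive x 1%R F (c * x)%R.
  have H := @is_deriveX R R^o id 2%N x 1%R 1%R (is_derive_id _ _).
  apply: is_derive_eq (@is_deriveZ R R^o R^o _ (c / 2) _ _ _ H) _.
  by rewrite /= /GRing.scale /= expr1; field.
have cF : continuous F.
  by move=> x; apply: differentiable_continuous; apply/derivable1_diffP; case: (dF x).
rewrite (@continuous_FTC2 _ _ F) //.
- have FE x : F x = (c / 2 * x ^+ 2)%R by rewrite expr2.
  by rewrite -EFinB !FE; congr (_%:E); field.
- apply: continuous_subspaceT => x; apply: cvgM; [exact: cvg_cst|exact: cvg_id].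
- split; first by move=> x _; case: (dF x).
    by apply: cvg_at_right_filter; exact: cF.
  by apply: cvg_at_left_filter; exact: cF.
- by move=> x _; rewrite derive1E; case: (dF x).
Qed.

Lemma measurable_step_slope (K g0 : R) : measurable_fun setT (step_slope K g0).
Proof.
pose f (x : R) : R := (if g0 <= x then 1 else 3)%R.
have -> : step_slope K g0 = (((fun=> K) \* (@Num.norm R R)) \* f)%R by [].
apply: measurable_funM.
  apply: measurable_funM; first exact: measurable_cst.
  exact: normr_measurable.
apply: measurable_fun_ifT => //.
exact: measurable_fun_ler.
Qed.

(** The absolute value in [step_slope] secures this on the whole line, also for negative
    arguments. *)
Lemma step_slope_ge0 (K g0 x : R) : (0 <= K)%R -> (0 <= step_slope K g0 x)%R.
Proof. by move=> K0; rewrite /step_slope !mulr_ge0 //; case: ifP. Qed.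

Lemma integral_step_slope (K g0 : R) : (0 <= K)%R -> (3^-1 <= g0)%R -> (g0 <= 1)%R ->
  \int[mu]_(x in `[3^-1%R, 1%R]) (step_slope K g0 x)%:E = (K * (g0 ^+ 2 + 3^-1))%:E.
Proof.
move=> K0 g3 g1.
have mf : measurable_fun [set: R] (EFin \o step_slope K g0).
  by apply/measurable_EFinP; exact: measurable_step_slope.
have x0 x : (3^-1 <= x -> `|x| = x :> R)%R.
  by move=> h; rewrite ger0_norm // (le_trans _ h) // invr_ge0.
rewrite (@itv_bndbnd_setU _ _ _ (BLeft g0)) ?bnd_simp //.
rewrite ge0_integral_setU //=; last 3 first.
- exact: measurable_funTS.
- by move=> x _; rewrite lee_fin step_slope_ge0.
- apply/disj_setPS => x [] /=; rewrite !in_itv /= => /andP[_ h1] /andP[h2 _].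
  by move: h1; rewrite ltNge h2.
rewrite (@eq_integral _ _ _ mu `[3^-1%R, g0[ (fun x => (3 * K * x)%:E)); last first.
  move=> x; rewrite inE /= in_itv /= => /andP[h1 h2].
  by rewrite /step_slope x0 // leNgt h2 /=; congr (_%:E); ring.
rewrite integral_itv_bndo_bndc; last first.
  apply/measurable_EFinP.
  exact: (measurable_funM (f := fun=> 3 * K) (g := id))%R.
rewrite integral_linear // (@eq_integral _ _ _ mu `[g0, 1%R] (fun x => (K * x)%:E)); last first.
  move=> x; rewrite inE /= in_itv /= => /andP[h1 h2].
  by rewrite /step_slope x0 ?h1 ?mulr1 // (le_trans g3 h1).
by rewrite integral_linear // -EFinD; congr (_%:E); field.
Qed.

End Integral.

(** [f] need not be measurable, so it is compared with a measurable majorant: the given bound plus a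
    function that is infinite on [N] and outside the interval, where [f] is only known to be
    nonnegative. The added function has integral 0. *)
Lemma uniform_lower_integral_le (R : realType) (I : finType) (S : {set I})
    (q : I -> R * R) (c : R) (N : set R) (f : R -> R) :
  0 <= c -> (forall i, i \in S -> [/\ 0 < (q i).1, 3^-1 < (q i).2 & (q i).2 <= 1]) ->
  countable N -> measurable N -> (forall x, 0 <= f x) ->
  (forall x, 3^-1 <= x -> x <= 1 -> ~ N x ->
     f x <= c * \sum_(i in S) step_slope (q i).1 (q i).2 x) ->
  (\int[uniform_prob (third_lt1 R)]_x (f x)%:E <=
    (2 * c * \sum_(i in S) (q i).1 * (q i).2)%:E)%E.
Proof.
move=> c0 hq cN mN f0 fB.
pose J : set R := `[3^-1, 1]%classic.
pose N' : set R := (~` J `|` N)%classic.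
have mN' : measurable N' by apply: measurableU => //; apply: measurableC; exact: measurable_itv.
pose h i x : \bar R := (if i \in S then c * step_slope (q i).1 (q i).2 x else 0)%:E.
have h0 i x : (0 <= h i x)%E.
  rewrite lee_fin; case: ifP => // /hq[K0 _ _].
  by rewrite mulr_ge0 // step_slope_ge0 // ltW.
have mh i : measurable_fun [set: R] (h i).
  apply/measurable_EFinP; case: (i \in S); last exact: measurable_cst.
  by apply: measurable_funM; [exact: measurable_cst|exact: measurable_step_slope].
pose B x : \bar R := (\sum_i h i x)%E.
have B0 x : (0 <= B x)%E by exact: sume_ge0.
have mB : measurable_fun [set: R] B by exact: emeasurable_sum.
pose G x : \bar R := (+oo * (\1_N' x)%:E)%E.
have G0 x : (0 <= G x)%E by rewrite mule_ge0 // lee_fin.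
have mG : measurable_fun [set: R] G.
  by apply: measurable_funeM; apply/measurable_EFinP; exact: measurable_indic.
apply: (@le_trans _ _ (\int[uniform_prob (third_lt1 R)]_x (B x + G x))%E).
  apply: ge0_le_integral_lower => x; first by rewrite lee_fin.
  have [xN|xN] := pselect (N' x).
    rewrite /G indicE mem_set // mule1 addey ?leey //.
    by rewrite gt_eqF // (lt_le_trans _ (B0 x)) // ltNyr.
  rewrite /G indicE memNset // mule0 adde0.
  have [xJ xN0] : J x /\ ~ N x.
    by split; [apply: contrapT => ?; apply: xN; left|move=> ?; apply: xN; right].
  move: xJ; rewrite /J /= in_itv /= => /andP[x3 x1].
  rewrite /B /h sumEFin lee_fin; apply: le_trans (fB x x3 x1 xN0) _.
  by rewrite -big_mkcond /= mulr_sumr.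
rewrite integral_uniform; last 2 first.
- exact: emeasurable_funD.
- by move=> x; exact: adde_ge0.
rewrite ge0_integralD //; last 2 first.
- exact: measurable_funTS.
- exact: measurable_funTS.
have -> : (\int[lebesgue_measure]_(x in `[(3^-1 : R)%R, 1%R]) G x = 0)%E.
  rewrite ge0_integralZl //; last first.
    by apply/measurable_EFinP/measurable_funTS; exact: measurable_indic.
  rewrite integral_indic // (_ : N' `&` _ = N `&` J)%classic.
    rewrite [X in (_ * X)%E](_ : _ = 0%E) ?mule0 //.
    apply: countable_lebesgue_measure0; apply: sub_countable cN.
    by apply: subset_card_le => x [].
  apply/seteqP; split=> x [H xJ]; split => //; first by case: H.
  by right.
rewrite adde0 /B ge0_integral_sum //; last by move=> i; exact: measurable_funTS (mh i).
rewrite (eq_bigr (fun i => (if i \in S then c * ((q i).1 * ((q i).2 ^+ 2 + 3^-1)) else 0)%:E)).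
  rewrite sumEFin -EFinM lee_fin -big_mkcond /= mulr_sumr [leRHS]mulr_sumr.
  apply: ler_sum => i /hq[K0 g3 g1].
  (* With density 3/2 the mean of each term is [K * (3 * g ^+ 2 + 1) / 2], and this is at most
     [2 * K * g] because [(3 * g - 1) * (1 - g)] is nonnegative. *)
  rewrite -subr_ge0 (_ : _ - _ = 3 / 2 * (c * (q i).1) * (((q i).2 - 3^-1) * (1 - (q i).2))).
    by rewrite !mulr_ge0 ?subr_ge0 // ltW.
  by field.
move=> i _; rewrite /h; case: ifP => [/hq[K0 g3 g1]|_]; last by rewrite integral0.
under eq_integral do rewrite EFinM.
rewrite ge0_integralZl //; last 2 first.
- by apply/measurable_EFinP/measurable_funTS; exact: measurable_step_slope.
- by move=> x _; rewrite lee_fin step_slope_ge0 // ltW.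
by rewrite integral_step_slope // ltW.
Qed.

(** * The worst-case and the expected ratio *)

Theorem theorem1 (R : realType) (n d : nat) (p : 'I_n -> R * R)
    (T : {set {set 'I_n}}) (A hatA : R -> nat -> {set {set 'I_n}})
    (hP : point_set d p)
    (hT : min_weight_triangulation p T)
    (hrun : forall gamma : R, admissible d p gamma ->
       algorithm_run d p gamma (A gamma) (hatA gamma))
    (hinv1 : forall (gamma : R) (i : nat), admissible d p gamma ->
       (i <= top_level d)%N -> invariant1 p gamma i (A gamma) (hatA gamma))
    (hinv2 : forall (gamma : R) (i : nat), admissible d p gamma ->
       (i <= top_level d)%N -> invariant2 p T gamma i (hatA gamma)) :
  let alpha (gamma : R) := weight p (A gamma (top_level d)) / weight p T in
  (forall gamma : R, admissible d p gamma ->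
     approx_mwt p T (alpha gamma) (A gamma (top_level d)) /\
     alpha gamma <= 24) /\
  ('E_(uniform_prob (third_lt1 R)) [alpha] <= 16%:E)%E.
Proof.
move=> alpha; have tT := hT.1.
have TK : T \subset complete_graph n by case: tT => -[].
have choose e : exists q : R * R, e \in T ->
    [/\ [/\ 0 < q.1, 3^-1 < q.2 & q.2 <= 1], edge_length p e = q.1 * q.2 &
        forall gamma, 3^-1 < gamma -> gamma < 1 ->
          rounded d gamma (edge_length p e) <= Num.sqrt 2 * step_slope q.1 q.2 gamma].
  have [eT|] := boolP (e \in T); last by exists (0, 0).
  have [l1 ld] := complete_edge_length hP (fintype.subsetP TK _ eT).
  have [K [g0 [? ? ? ? ?]]] := rounded_step_slope l1 ld.
  by exists (K, g0).
have [q hq] := boolp.choice choose.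
pose S gamma := \sum_(e in T) step_slope (q e).1 (q e).2 gamma.
have main gamma : admissible d p gamma -> weight p (A gamma (top_level d)) <= 8 * S gamma.
  move=> adm; have [g3 g1 _] := adm.
  apply: le_trans (weight_output hP tT g3 g1 (hrun _ adm) (fun i => hinv1 gamma i adm)
    (fun i => hinv2 gamma i adm)) _.
  have -> : 8 * S gamma = 4 * Num.sqrt 2 * (Num.sqrt 2 * S gamma).
    rewrite mulrA -(mulrA 4) -expr2 sqr_sqrtr //; ring.
  rewrite ler_wpM2l ?mulr_ge0 ?sqrtr_ge0 // mulr_sumr.
  by apply: ler_sum => e /hq[_ _]; apply.
have w0 (E : {set {set 'I_n}}) : 0 <= weight p E.
  by apply: sumr_ge0 => e _; exact: edge_length_ge0.
have bound gamma : admissible d p gamma -> weight p (A gamma (top_level d)) <= 24 * weight p T.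
  move=> adm; have [g3 g1 _] := adm; apply: le_trans (main _ adm) _.
  rewrite (_ : 24 = 8 * 3); last by rewrite -natrM.
  rewrite -mulrA ler_pM2l // mulr_sumr; apply: ler_sum => e /hq[[K0 gq3 gq1] -> _].
  have g0 : 0 < gamma by apply: lt_trans g3; rewrite invr_gt0.
  (* Both branches are at most [3 * K * g]: the first since [gamma < 1 < 3 * g], the second since
     [gamma < g]. *)
  rewrite /step_slope gtr0_norm //; case: (leP (q e).2 gamma) => h.
    have h3 : 0 <= 3 * (q e).2 - gamma by lra.
    by have := mulr_ge0 (ltW K0) h3; lra.
  have h3 : 0 <= (q e).2 - gamma by rewrite subr_ge0 ltW.
  by have := mulr_ge0 (ltW K0) h3; lra.
split=> [gamma adm|].
  have [g3 g1 _] := adm.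
  have tA := output_triangulation hP g3 g1 (hrun _ adm) (fun i => hinv1 gamma i adm).
  have [wT|wT] := eqVneq (weight p T) 0.
    (* Division by 0 makes [alpha] equal to 0 here, and [bound] gives weight 0 for the output. *)
    rewrite /approx_mwt /alpha wT invr0 !mulr0; split=> //; split=> //.
    by have := bound _ adm; rewrite wT mulr0.
  split; first by split; rewrite // /alpha divfK.
  rewrite /alpha ler_pdivrMr; first exact: bound.
  by rewrite lt_neqAle eq_sym wT w0.
rewrite unlock.
(* The factor 8 from [main], doubled by the mean, gives 16. *)
apply: (le_trans (uniform_lower_integral_le (S := T) (q := q) (c := 8 / weight p T)
  _ _ (countable_exceptional p) (measurable_exceptional p) _ _)).
- by rewrite divr_ge0.
- by move=> e /hq[].
- by move=> x; rewrite divr_ge0.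
- move=> x x3 x1 ex; rewrite /alpha mulrAC ler_wpM2r ?invr_ge0 //.
  exact/main/admissibleP.
have -> : \sum_(e in T) (q e).1 * (q e).2 = weight p T.
  by apply: eq_bigr => e /hq[_ -> _].
rewrite lee_fin; have [->|wT] := eqVneq (weight p T) 0; first by rewrite mulr0.
by rewrite mulrA divfK // -natrM.
Qed.
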